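(* Let $\mathbb{K}$ be a field, let $G$ be a graph with vertex set $\{v_1,\dots,v_n\}$, let $S=\mathbb{K}[x_1,\dots,x_n]$, and let $I=I(G)\subseteq S$ be the edge ideal of $G$. Let $p$ be the number of bipartite connected components of $G$. Then for every integer $k\geq 1$, we have ${\rm sdepth}(S/\overline{I^k})\geq p$. In particular, $S/\overline{I^k}$ satisfies Stanley's inequality for every integer $k\gg 0$ (i.e. there is $k_0$ such that ${\rm depth}(S/\overline{I^k})\leq {\rm sdepth}(S/\overline{I^k})$ for all $k\geq k_0$).
   Context: Graphs are finite and simple. The edge ideal of $G$ is $I(G)=(x_ix_j : \{v_i,v_j\}\in E(G))\subseteq S$. For an ideal $J\subseteq S$, $\overline{J}$ denotes its integral closure; if $J$ is a monomial ideal, $\overline{J}$ is the monomial ideal generated by all monomials $u\in S$ such that $u^r\in J^r$ for some integer $r\geq 1$. An isolated vertex counts as a bipartite connected component. Stanley depth: let $M$ be a finitely generated $\mathbb{Z}^n$-graded $S$-module. For a homogeneous $u\in M$ and $Z\subseteq\{x_1,\dots,x_n\}$, the $\mathbb{K}$-subspace $u\mathbb{K}[Z]$ of $M$ generated by all $uv$ with $v$ a monomial in $\mathbb{K}[Z]$ is called a Stanley space of dimension $|Z|$ if it is a free $\mathbb{K}[Z]$-module. A Stanley decomposition $\mathcal{D}$ of $M$ is a decomposition of $M$ (as a $\mathbb{K}$-vector space) as a finite direct sum of Stanley spaces; ${\rm sdepth}(\mathcal{D})$ is the minimum dimension of a Stanley space in $\mathcal{D}$, and ${\rm sdepth}(M)$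 is the maximum of ${\rm sdepth}(\mathcal{D})$ over all Stanley decompositions $\mathcal{D}$ of $M$. By convention ${\rm sdepth}(0)=\infty$. $M$ satisfies Stanley's inequality if ${\rm depth}(M)\leq{\rm sdepth}(M)$. *)

(* Defs.v *)
From HB Require Import structures.
From mathcomp Require Import all_boot all_order all_algebra ring_quotient.
From mathcomp Require Import boolp.
From mathcomp Require Import mpoly.

Set Implicit Arguments.
Unset Strict Implicit.
Unset Printing Implicit Defensive.

Import GRing.Theory.
Local Open Scope ring_scope.

Inductive enat := Fin of nat | Inf.

Definition lee (a b : enat) : bool :=
  match a, b with
  | _, Inf => true
  | Inf, Fin _ => false
  | Fin m, Fin n => (m <= n)%N
  end.

Definition mine (a b : enat) : enat := if lee a b then a else b.

Definition ubound_nat (A : enat -> Prop) : pred nat :=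
  fun b => `[< forall a, A a -> lee a (Fin b) >].

Definition supe (A : enat -> Prop) : enat :=
  match pselect (exists b, ubound_nat A b) with
  | left ub => Fin (ex_minn ub)
  | right _ => Inf
  end.

Lemma supe_lub (A : enat -> Prop) (s : enat) :
  lee (supe A) s <-> (forall a, A a -> lee a s).
Proof.
have ltrans a b c : lee a b -> lee b c -> lee a c.
  by case: a b c => [a|] [b|] [c|] //=; exact: leq_trans.
rewrite /supe; case: pselect => [ub|nub].
  case: ex_minnP => m /asboolP mub mmin; split=> [le_ms a Aa|].
    exact: ltrans (mub a Aa) le_ms.
  by case: s => [s|] //= sub; apply: mmin; apply/asboolP.
split; first by case: s => // _ a; case: a.
by case: s => // s sub; case: nub; exists s; apply/asboolP.
Qed.

Section Ideals.
Variable R : comNzRingType.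

Record ideal := Ideal {
  ideal_mem :> R -> Prop;
  ideal0 : ideal_mem 0;
  idealD : forall f g, ideal_mem f -> ideal_mem g -> ideal_mem (f + g);
  idealM : forall a f, ideal_mem f -> ideal_mem (a * f)
}.

Implicit Types (A : R -> Prop) (I J : ideal).

Definition gen_mem A (f : R) : Prop :=
  exists r (a g : 'I_r -> R), (forall i, A (g i)) /\ f = \sum_i a i * g i.

Lemma gen_mem0 A : gen_mem A 0.
Proof.
by exists 0%N, (fun _ => 0), (fun _ => 0); split; [case|rewrite big_ord0].
Qed.

Lemma gen_memD A f g : gen_mem A f -> gen_mem A g -> gen_mem A (f + g).
Proof.
move=> [r [a [u [Au ->]]]] [s [b [v [Av ->]]]].
exists (r + s)%N,
  (fun i => match split i with inl j => a j | inr j => b j end),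
  (fun i => match split i with inl j => u j | inr j => v j end).
split=> [i|]; first by case: (split i).
rewrite big_split_ord /=; congr (_ + _); apply: eq_bigr => i _.
  case: splitP => j /= ij; first by rewrite (ord_inj ij).
  by have := ltn_ord i; rewrite ij ltnNge leq_addr.
case: splitP => j /= ij; first by have := ltn_ord j; rewrite -ij ltnNge leq_addr.
by rewrite (ord_inj (addnI ij)).
Qed.

Lemma gen_memM A a f : gen_mem A f -> gen_mem A (a * f).
Proof.
move=> [r [b [u [Au ->]]]]; exists r, (fun i => a * b i), u; split=> //.
by rewrite mulr_sumr; apply: eq_bigr => i _; rewrite mulrA.
Qed.

Definition gen A : ideal := Ideal (gen_mem0 A) (@gen_memD A) (@gen_memM A).

Lemma gen_min A I : (forall f, A f -> I f) -> forall f, gen A f -> I f.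
Proof.
move=> AI f [r [a [u [Au ->]]]]; elim/big_ind: _ => [|x y|i _].
- exact: ideal0.
- exact: idealD.
- by apply: idealM; apply: AI.
Qed.

Lemma gen_sub A f : A f -> gen A f.
Proof.
by move=> Af; exists 1%N, (fun=> 1), (fun=> f); rewrite big_ord1 mul1r.
Qed.

Definition ideal_mul I J : ideal :=
  gen (fun h => exists f g, [/\ I f, J g & h = f * g]).

Definition ideal_pow I (k : nat) : ideal :=
  iter k (ideal_mul I) (gen (fun f => f = 1)).

Lemma ideal_pow0 I f : ideal_pow I 0 f.
Proof. by rewrite -[f]mulr1; apply/idealM/gen_sub. Qed.

Lemma ideal_sum I (T : Type) (s : seq T) (P : pred T) (F : T -> R) :
  (forall i, P i -> I (F i)) -> I (\sum_(i <- s | P i) F i).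
Proof. by move=> IF; elim/big_ind: _ => //; [exact: ideal0|exact: idealD]. Qed.

Lemma idealN I f : I f -> I (- f).
Proof. by rewrite -mulN1r; exact: idealM. Qed.

(* [I : h], only used to push induction through [gen].                        *)
Definition colon I (h : R) : ideal.
Proof.
refine (@Ideal (fun f => I (f * h)) _ _ _) => [|f g If Ig|a f If].
- by rewrite mul0r; exact: ideal0.
- by rewrite mulrDl; exact: idealD.
- by rewrite -mulrA; exact: idealM.
Defined.

Lemma ideal_powM I i j f g :
  ideal_pow I i f -> ideal_pow I j g -> ideal_pow I (i + j) (f * g).
Proof.
move=> If Ig; elim: i f If => [|i IHi] f If; first by rewrite add0n; exact: idealM.
apply: (@gen_min _ (colon (ideal_pow I (i.+1 + j)) g) _ f If) => _ [u [v [Iu Iv ->]]] /=.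
rewrite -mulrA; apply: (gen_sub (A := fun h => _)).
by exists u, (v * g); split=> //; exact: IHi.
Qed.

(* Integral closure, via equations of integral dependence                     *)
(*   f^m + c_1 f^(m-1) + ... + c_m = 0  with  c_i in I^i.                     *)

Definition integral_over I (f : R) : Prop :=
  exists (m : nat) (c : nat -> R),
    [/\ (0 < m)%N,
        forall i, (1 <= i <= m)%N -> ideal_pow I i (c i) &
        f ^+ m + \sum_(1 <= i < m.+1) c i * f ^+ (m - i) = 0].

(* That the elements integral over [I] form an ideal is deduced from the      *)
(* corresponding fact for integrality over the Rees ring                      *)
(* {p in R[X] | forall i, p_i in I^i}: f is integral over [I] iff f X is      *)
(* integral over the Rees ring.                                               *)

Section Rees.
Variable I : ideal.

Definition rees_pred : {pred {poly R}} :=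
  fun p => `[< forall i, ideal_pow I i p`_i >].

Fact rees_subring : subring_closed rees_pred.
Proof.
split=> [|p q /asboolP Ip /asboolP Iq|p q /asboolP Ip /asboolP Iq]; apply/asboolP=> i.
- rewrite coef1; case: i => [|i]; first exact: ideal_pow0.
  exact: ideal0.
- by rewrite coefB; apply: idealD => //; apply: idealN.
- rewrite coefM; apply: ideal_sum => j _.
  by rewrite -{1}(subnKC (leq_ord j)); exact: ideal_powM.
Qed.

HB.instance Definition _ :=
  GRing.isSubringClosed.Build {poly R} rees_pred rees_subring.

Record rees := Rees { rees_val : {poly R}; _ : rees_val \in rees_pred }.

HB.instance Definition _ := [isSub of rees for rees_val].
HB.instance Definition _ := [Choice of rees by <:].
HB.instance Definition _ := [SubChoice_isSubComNzRing of rees by <:].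

Definition rees_in : {rmorphism rees -> {poly R}} := val.

Lemma rees_integral f :
  integral_over I f <-> integralOver rees_in (f *: 'X).
Proof.
split.
  move=> [m [c [m_gt0 Ic eq0]]].
  pose d i : {poly R} := if (0 < i <= m)%N then (c i) *: 'X^i else 0.
  have dP i : d i \in rees_pred.
    apply/asboolP => j; rewrite /d; case: ifP => [i_m|_]; last first.
      by rewrite coef0; exact: ideal0.
    rewrite coefZ coefXn; case: eqP => [->|_]; first by rewrite mulr1; exact: Ic.
    by rewrite mulr0; exact: ideal0.
  pose q : {poly rees} := 'X^m + \poly_(j < m) Rees (dP (m - j)%N).
  have qmon : q \is monic.
    rewrite monicE lead_coefDl ?lead_coefXn //.
    by rewrite size_polyXn ltnS size_poly.
  exists q => //; apply/rootP.
  pose Q : {poly {poly R}} := 'X^m + \poly_(j < m) d (m - j)%N.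
  have -> : map_poly rees_in q = Q.
    apply/polyP=> j; rewrite /q /Q coef_map !coefD !coefXn !coef_poly.
    rewrite raddfD -[X in X + _]/(rees_in _) (rmorph_nat rees_in).
    by case: ifP => _ //=; rewrite raddf0.
  suff QE : Q.[f *: 'X] = 0 by exact: QE.
  have -> : Q.[f *: 'X] = (f *: 'X) ^+ m + \sum_(j < m) d (m - j)%N * (f *: 'X) ^+ j.
    by rewrite /Q hornerD hornerXn horner_poly.
  have dE (j : 'I_m) :
      d (m - j)%N * (f *: 'X) ^+ j = (c (m - j)%N * f ^+ j) *: 'X^m.
    have -> : d (m - j)%N = c (m - j)%N *: 'X^(m - j).
      by rewrite /d subn_gt0 ltn_ord leq_subr.
    rewrite exprZn -scalerAl -scalerAr -exprD scalerA subnK //.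
    exact: ltnW.
  rewrite (eq_bigr _ (fun j _ => dE j)) exprZn -scaler_suml -scalerDl.
  suff -> : f ^+ m + \sum_(j < m) c (m - j)%N * f ^+ j = 0 by rewrite scale0r.
  rewrite -[RHS]eq0; congr (_ + _).
  rewrite big_add1 /= big_mkord (reindex_inj rev_ord_inj) /=.
  by apply: eq_bigr => j _; rewrite subKn ?ltn_ord.
case=> q qmon; set Q : {poly {poly R}} := map_poly _ q => /rootP rootQ.
have QE j : Q`_j = rees_in q`_j by exact: coef_map.
set m := (size q).-1; have sq : size q = m.+1.
  by rewrite prednK // size_poly_gt0 monic_neq0.
have sQ : size Q = m.+1.
  by rewrite -sq; apply: size_map_inj_poly; [exact: val_inj|exact: raddf0].
have Qm : Q`_m = 1.
  have qm : q`_m = 1 by move/monicP: qmon.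
  by rewrite QE qm; exact: rmorph1.
have : \sum_(j < m) Q`_j * (f *: 'X) ^+ j + (f *: 'X) ^+ m = 0.
  have : Q.[f *: 'X] = 0 by exact: rootQ.
  by rewrite horner_coef sQ big_ord_recr /= Qm mul1r.
move=> /(congr1 (fun p : {poly R} => p`_m)).
rewrite coef0 exprZn coefD coefZ coefXn eqxx mulr1 coef_sum => eq0.
have m_gt0 : (0 < m)%N.
  case: (posnP m) => // m0; move: eq0; rewrite m0 big_ord0 expr0 add0r.
  by move/eqP; rewrite oner_eq0.
exists m, (fun i => (Q`_(m - i))`_i); split=> // [i _|].
  by rewrite QE; case: (q`_(m - i)) => p /= /asboolP; exact.
rewrite -[RHS]eq0 addrC; congr (_ + _).
rewrite big_add1 /= big_mkord (reindex_inj rev_ord_inj) /=.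
apply: eq_bigr => j _; rewrite subnSK // subKn ?(ltnW (ltn_ord j)) //.
rewrite exprZn -scalerAr coefZ coefMXn.
by rewrite ltnNge (ltnW (ltn_ord j)) /= mulrC.
Qed.

Lemma integral_over0 : integral_over I 0.
Proof. by apply/rees_integral; rewrite scale0r; exact: integral0. Qed.

Lemma integral_overD f g :
  integral_over I f -> integral_over I g -> integral_over I (f + g).
Proof.
move=> /rees_integral If /rees_integral Ig; apply/rees_integral.
by rewrite scalerDl; exact: integral_add.
Qed.

Lemma integral_overM a f : integral_over I f -> integral_over I (a * f).
Proof.
move=> [m [c [m_gt0 Ic eq0]]]; exists m, (fun i => a ^+ i * c i).
split=> // [i i_m|]; first exact/idealM/Ic.
move/(congr1 ( *%R (a ^+ m))): eq0; rewrite mulr0 => eq0; apply: etrans eq0; rewrite mulrDr.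
rewrite exprMn; congr (_ + _).
rewrite mulr_sumr; apply: eq_big_nat => i /andP[_ i_m].
have -> : a ^+ m = a ^+ i * a ^+ (m - i) by rewrite -exprD subnKC.
by rewrite exprMn -!mulrA (mulrCA (c i)).
Qed.

Definition integral_closure : ideal :=
  Ideal integral_over0 integral_overD integral_overM.

End Rees.

Section QuotientModule.
Variable I : ideal.

Definition ideal_pred : {pred R} := fun f => `[< I f >].

Fact ideal_pred_zmod : zmod_closed ideal_pred.
Proof.
split=> [|f g /asboolP If /asboolP Ig]; apply/asboolP; first exact: ideal0.
by apply: idealD => //; exact: idealN.
Qed.

HB.instance Definition _ := GRing.isZmodClosed.Build R ideal_pred ideal_pred_zmod.

Definition quot_mod := Quotient.quot ideal_pred.
HB.instance Definition _ := GRing.Zmodule.on quot_mod.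

Definition quot_pi (f : R) : quot_mod := \pi_(Quotient.quot ideal_pred)%qT f.
Definition quot_repr (x : quot_mod) : R := repr x.

Lemma quot_reprK x : quot_pi (quot_repr x) = x.
Proof. exact: reprK. Qed.

Lemma quot_piP f g : quot_pi f = quot_pi g <-> I (f - g).
Proof.
split=> [/eqP|If].
  by rewrite /quot_pi -Quotient.idealrBE => /asboolP.
by apply/eqP; rewrite /quot_pi -Quotient.idealrBE; apply/asboolP.
Qed.

Lemma quot_piD f g : quot_pi (f + g) = quot_pi f + quot_pi g.
Proof. exact: raddfD. Qed.

Definition quot_scale (a : R) (x : quot_mod) : quot_mod := quot_pi (a * quot_repr x).

Lemma quot_scale_pi a f : quot_scale a (quot_pi f) = quot_pi (a * f).
Proof.
apply/quot_piP; rewrite -mulrBr; apply: idealM.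
by apply/quot_piP; rewrite quot_reprK.
Qed.

Fact quot_scaleA a b x : quot_scale a (quot_scale b x) = quot_scale (a * b) x.
Proof. by rewrite -[x]quot_reprK !quot_scale_pi mulrA. Qed.

Fact quot_scale1 : left_id 1 quot_scale.
Proof. by move=> x; rewrite -[x]quot_reprK quot_scale_pi mul1r. Qed.

Fact quot_scaleDr : right_distributive quot_scale +%R.
Proof.
move=> a x y; rewrite -[x]quot_reprK -[y]quot_reprK -quot_piD !quot_scale_pi.
by rewrite mulrDr quot_piD.
Qed.

Fact quot_scaleDl x : {morph quot_scale^~ x : a b / a + b}.
Proof.
by move=> a b /=; rewrite -[x]quot_reprK !quot_scale_pi mulrDl quot_piD.
Qed.

HB.instance Definition _ := GRing.Zmodule_isLmodule.Build R quot_mod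
  quot_scaleA quot_scale1 quot_scaleDr quot_scaleDl.

Lemma quot_piZ a f : a *: quot_pi f = quot_pi (a * f).
Proof. exact: quot_scale_pi. Qed.

End QuotientModule.

End Ideals.

Section Depth.
Variables (K : fieldType) (n : nat).
Local Notation S := {mpoly K[n]}.

Definition max_ideal : ideal S := gen (fun f => exists i : 'I_n, f = 'X_i).

Section Module.
Variable M : lmodType S.

Definition seq_submod (fs : seq S) (w : M) : Prop :=
  exists v : 'I_(size fs) -> M, w = \sum_(i < size fs) fs`_i *: v i.

Definition regular_seq (fs : seq S) : Prop :=
  (forall i, (i < size fs)%N -> forall w : M,
     seq_submod (take i fs) (fs`_i *: w) -> seq_submod (take i fs) w)
  /\ (exists w : M, ~ seq_submod fs w).

(* Largest length of an M-regular sequence in (x_1, ..., x_n).                *)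
Definition depth : enat :=
  supe (fun d => exists fs : seq S,
    [/\ forall i, (i < size fs)%N -> max_ideal fs`_i,
        regular_seq fs & d = Fin (size fs)]).

(* f \in K[Z], as a subring of S.                                             *)
Definition in_vars (Z : {set 'I_n}) (f : S) : Prop :=
  forall m, m \in msupp f -> forall i, i \notin Z -> m i = 0%N.

Definition stanley_space (u : M) (Z : {set 'I_n}) (w : M) : Prop :=
  exists2 f, in_vars Z f & w = f *: u.

(* u K[Z] is free over K[Z] with basis u; in particular u <> 0.               *)
Definition stanley_free (u : M) (Z : {set 'I_n}) : Prop :=
  forall f, in_vars Z f -> f *: u = 0 -> f = 0.

(* [hom] stands for the set of Z^n-homogeneous elements of M.                 *)
Variable hom : M -> Prop.

Definition stanley_decomposition r (u : 'I_r -> M) (Z : 'I_r -> {set 'I_n}) : Prop :=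
  [/\ forall i, hom (u i) /\ stanley_free (u i) (Z i),
      forall w : M, exists v : 'I_r -> M,
        (forall i, stanley_space (u i) (Z i) (v i)) /\ w = \sum_i v i &
      forall v : 'I_r -> M,
        (forall i, stanley_space (u i) (Z i) (v i)) ->
        \sum_i v i = 0 -> forall i, v i = 0].

Definition sdepth : enat :=
  supe (fun d => exists r (u : 'I_r -> M) (Z : 'I_r -> {set 'I_n}),
    stanley_decomposition u Z /\ d = \big[mine/Inf]_(i < r) Fin #|Z i|).

End Module.

(* For a monomial ideal J, the Z^n-graded pieces of S / J are the images of   *)
(* those of S, namely of the lines K x^m.                                     *)
Definition quot_hom (J : ideal S) (w : quot_mod J) : Prop :=
  exists (c : K) (m : 'X_{1..n}), w = quot_pi J (c *: 'X_[m]).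

Definition depth_quot (J : ideal S) : enat := depth (quot_mod J).
Definition sdepth_quot (J : ideal S) : enat := sdepth (@quot_hom J).

End Depth.

Section Graph.
Variables (n : nat) (e : rel 'I_n).

Definition edge_ideal (K : fieldType) : ideal {mpoly K[n]} :=
  gen (fun f => exists i j : 'I_n, e i j /\ f = 'X_i * 'X_j).

Definition components : {set {set 'I_n}} :=
  equivalence_partition (connect e) [set: 'I_n].

Definition bipartite (C : {set 'I_n}) : bool :=
  [exists A : {set 'I_n}, [forall i in C, [forall j in C,
     e i j ==> ((i \in A) != (j \in A))]]].

Definition num_bipartite_components : nat :=
  #|[set C in components | bipartite C]|.

End Graph.

(* Main.v *)
From HB Require Import structures.
From mathcomp Require Import boolp mpoly zify.
Require Import Defs.
From mathcomp Require Import all_boot all_algebra.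

Set Implicit Arguments.
Unset Strict Implicit.
Unset Printing Implicit Defensive.

(** Let J be the integral closure of I^k.  Both halves rest on a description of
    the monomials in J by covers.  Call cover a pair (L, R) of vertex sets such
    that u is in L or v is in R for each edge uv, and let its weight at an
    exponent c be c(L) + c(R).  Then x^c lies in J exactly when every cover has
    weight at least 2k at c ([closure_heavy]).  Indeed a cover defines a monomial
    valuation which is at least 2k on I^k, and such bounds pass to integral
    closures ([integral_closure_weight]).  Conversely, Koenig's theorem with
    capacities ([koenig]) finds 2k edges whose product divides x^(2c), so that
    the square of x^c lies in the square of I^k.

    Lower bound for the Stanley depth.  On a bipartite component, some cover of
    least weight at c avoids a vertex v ([free_exists]); then c may grow at v
    without changing the least weight.  Choosing the least such v in each of the
    p bipartite components gives p directions that do not change along the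
    orthant they span ([is_direction_up]), and along which membership in J does
    not change either ([heavy_above]).  The choice in a component only depends on
    the coordinates in that component, so the exponents outside J with given
    directions split into orthants, each having a least corner.  Truncating
    coordinates at 2k leaves finitely many of them.  This is a Stanley
    decomposition into spaces of dimension at least p ([sdepth_closure_ge]).

    Upper bound for the depth.  A nonzero class of degree p in the cohomology of
    the Koszul complex of the variables with coefficients in a module bounds the
    length of regular sequences by p ([depth_le]).  For large k there is a
    monomial x^a deep in the cone spanned by the edges (of degree 2k - 2, or 2k - 1
    if some component is not bipartite; x^a = 1 if there are no edges) for which
    the annihilator of x^a in S / J is the sum of the products (A)(B) over the
    bipartite components with sides A and B, and of the ideal of the variables of
    the nonbipartite components.  When no vertex is isolated, the squarefree
    monomials whose product with x^a stays outside J form the join of p pairs of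
    disjoint simplices, which has the cohomology of a sphere.  Its
    class is the exterior product, over the components, of the restrictions of
    the cochain x = (x_v) to one side, times x^a ([side_cochain_cocycle]); it is
    detected by the cycle that is a product of differences of two vertices, one
    on each side ([pairing_wedge], [pairing_cochain]).  An isolated vertex adds
    as a further factor the constant cochain supported at that vertex.  Hence
    the depth of S / J is at most p for large k ([depth_closure_le]), and the
    lower bound gives Stanley's inequality. *)

(** * Covers and matchings of a bipartite graph with capacities *)

Lemma sum_setUI (X : finType) (a : X -> nat) (L L' : {set X}) :
  (\sum_(x in L :|: L') a x + \sum_(x in L :&: L') a x =
   \sum_(x in L) a x + \sum_(x in L') a x)%N.
Proof.
rewrite big_mkcond [X in (_ + X)%N]big_mkcond [in RHS]big_mkcond.
rewrite [X in _ = (_ + X)%N]big_mkcond -!big_split /=; apply: eq_bigr => x _.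
by rewrite !inE; case: (x \in L); case: (x \in L'); rewrite /= ?addn0.
Qed.

Lemma sum_decr (X : finType) (a : X -> nat) (x : X) (L : {set X}) :
  (0 < a x ->
  \sum_(z in L) (a z - (z == x)) + (x \in L) = \sum_(z in L) a z)%N.
Proof.
move=> ax; case: (boolP (x \in L)) => xL.
  rewrite (bigD1 x) //= [in RHS](bigD1 x) //= eqxx.
  rewrite [X in (_ + X + _)%N](eq_bigr a) => [|z /andP[_ /negPf->]]; last by rewrite subn0.
  by lia.
rewrite addn0; apply: eq_bigr => z zL; case: eqP => [zx|]; last by rewrite subn0.
by rewrite -zx zL in xL.
Qed.

Section Koenig.
Variables (X Y : finType) (r : X -> Y -> bool).

Definition bicover (L : {set X}) (R : {set Y}) : bool :=
  [forall x, forall y, r x y ==> (x \in L) || (y \in R)].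

Implicit Types (L : {set X}) (R : {set Y}).

Lemma bicoverP L R :
  reflect (forall x y, r x y -> (x \in L) || (y \in R)) (bicover L R).
Proof.
apply: (iffP forallP) => [H x y rxy|H x]; last by apply/forallP => y; apply/implyP/H.
by have /forallP/(_ y)/implyP := H x; apply.
Qed.

Lemma bicoverUI L R L' R' :
  bicover L R -> bicover L' R' -> bicover (L :|: L') (R :&: R').
Proof.
move=> /bicoverP H /bicoverP H'; apply/bicoverP => x y rxy.
by rewrite !inE; case/orP: (H _ _ rxy) => ->; case/orP: (H' _ _ rxy) => ->; rewrite ?orbT.
Qed.

Lemma bicoverIU L R L' R' :
  bicover L R -> bicover L' R' -> bicover (L :&: L') (R :|: R').
Proof.
move=> /bicoverP H /bicoverP H'; apply/bicoverP => x y rxy.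
by rewrite !inE; case/orP: (H _ _ rxy) => ->; case/orP: (H' _ _ rxy) => ->; rewrite ?orbT.
Qed.

Definition bicover_weight (a : X -> nat) (b : Y -> nat) L R :=
  (\sum_(x in L) a x + \sum_(y in R) b y)%N.

(** The induction step of Koenig's theorem: an edge is found that no cover of
    minimal weight N covers twice, so that a unit of capacity can be removed at
    both of its ends while the minimum drops by only one.  Among the covers of
    weight N whose right part has positive weight, one (L0, R0) of least right
    weight is taken, and the edge leaves L0 and ends in R0.  A cover (L, R) of
    weight N meeting that edge twice would yield (L U L0, R n R0), again of
    weight N, whose left part is strictly heavier than L0; its right part still
    contains the end of the edge and is lighter than R0. *)
Lemma loose_edge (a : X -> nat) (b : Y -> nat) N : (0 < N)%N ->
  (forall L R, bicover L R -> (N <= bicover_weight a b L R)%N) ->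
  exists x y, [/\ r x y, (0 < a x)%N, (0 < b y)%N &
    forall L R, bicover L R -> x \in L -> y \in R ->
      (N < bicover_weight a b L R)%N].
Proof.
move=> N0 minN.
pose tight (P : {set X} * {set Y}) :=
  [&& bicover P.1 P.2, bicover_weight a b P.1 P.2 == N & (0 < \sum_(y in P.2) b y)%N].
case: (pickP tight) => [P0 P0t|nt].
  case: (arg_minnP (fun P : {set X} * {set Y} => \sum_(y in P.2) b y)%N P0t) => -[L0 R0]
      /and3P[/= cov0 /eqP w0 b0] min0.
  have [y yR by0] : exists2 y, y \in R0 & (0 < b y)%N.
    apply/exists_inP; apply: contraTT b0; rewrite negb_exists_in => /forall_inP H.
    by rewrite -leqNgt leqn0 sum_nat_eq0; apply/forall_inP => y /H; rewrite -leqNgt leqn0.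
  (* Otherwise y could be dropped from R0 after adding vertices of weight 0 to L0. *)
  have [x [rxy xL ax]] : exists x, [/\ r x y, x \notin L0 & (0 < a x)%N].
    apply: contrapT => nex.
    pose L1 := L0 :|: [set x | a x == 0%N].
    have /minN : bicover L1 (R0 :\ y).
      apply/bicoverP => x y' rxy; rewrite !inE.
      move/bicoverP: cov0 => /(_ _ _ rxy).
      case: (boolP (x \in L0)) => //= xL ->; rewrite andbT.
      case: (eqVneq y' y) rxy => [-> rxy|_ _]; rewrite ?orbT // orbF.
      by case: (posnP (a x)) => // ax; case: nex; exists x.
    rewrite -w0 /bicover_weight [X in (X <= _)%N](_ : _ =
        \sum_(x in L0) a x + b y + \sum_(z in R0 :\ y) b z)%N; last first.
      by rewrite (big_setD1 y yR) /= addnA.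
    have := sum_setUI a L0 [set x | a x == 0%N].
    have -> : (\sum_(x in [set x | a x == 0%N]) a x = 0)%N.
      by rewrite big1 // => z; rewrite inE => /eqP.
    rewrite -/L1; lia.
  exists x, y; split=> // L R cov xL' yR'.
  rewrite ltn_neqAle minN // andbT; apply/eqP => w.
  have c1 := bicoverUI cov cov0; have c2 := bicoverIU cov cov0.
  have m1 := minN _ _ c1; have m2 := minN _ _ c2.
  have sa := sum_setUI a L L0; have sb := sum_setUI b R R0.
  move: (m1) (m2) (w) (w0); rewrite /bicover_weight => m1' m2' w' w0'.
  have w1 : bicover_weight a b (L :|: L0) (R :&: R0) = N by rewrite /bicover_weight; lia.
  have bp : (0 < \sum_(y in R :&: R0) b y)%N.
    by rewrite (big_setD1 y) ?inE ?yR' //=; lia.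
  have /min0 /= : tight (L :|: L0, R :&: R0) by rewrite /tight /= c1 w1 eqxx bp.
  have : (\sum_(x in L0) a x + a x <= \sum_(x in L :|: L0) a x)%N.
    rewrite [X in (_ <= X)%N](big_setD1 x) ?inE ?xL' //= addnC leq_add2l.
    rewrite [X in (_ <= X)%N](big_setID L0) /=.
    rewrite (_ : (_ :\ _) :&: _ = L0) ?leq_addr //.
    apply/setP => z; rewrite !inE; case: (boolP (z \in L0)) => zL;
        rewrite ?orbT ?andbF //= andbT.
    by case: eqP => // zx; rewrite -zx zL in xL.
  move: w1; rewrite /bicover_weight; lia.
(* No minimal cover has weight on the right, so every edge between vertices of
   positive capacity will do. *)
have [x [y [rxy ax by0]]] : exists x y, [/\ r x y, (0 < a x)%N & (0 < b y)%N].
  apply: contrapT => nex.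
  have /minN : bicover [set x | a x == 0%N] [set y | b y == 0%N].
    apply/bicoverP => x y rxy; rewrite !inE.
    by case: (posnP (a x)) => //= ax; case: (posnP (b y)) => //= by0; case: nex; exists x, y.
  rewrite /bicover_weight !big1 => [|y|x]; rewrite ?inE; try by move/eqP.
  by lia.
exists x, y; split=> // L R cov xL yR.
rewrite ltn_neqAle minN // andbT; apply/eqP => w.
have := nt (L, R); rewrite /tight /= cov -w eqxx /=.
by rewrite (big_setD1 y) //=; lia.
Qed.

(** Each step removes the edge of [loose_edge] together with one unit of
    capacity at both of its ends. *)
Theorem koenig (a : X -> nat) (b : Y -> nat) N :
  (forall L R, bicover L R -> (N <= bicover_weight a b L R)%N) ->
  exists s : seq (X * Y), [/\ size s = N, all (fun p => r p.1 p.2) s,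
    forall x, (count (fun p => p.1 == x) s <= a x)%N &
    forall y, (count (fun p => p.2 == y) s <= b y)%N].
Proof.
elim: N a b => [|N IH] a b minN; first by exists [::].
have [x [y [rxy ax by0 loose]]] := loose_edge (ltn0Sn N) minN.
have [L R cov|s [ss es ca cb]] :=
    IH (fun z => a z - (z == x))%N (fun z => b z - (z == y))%N.
  have := loose _ _ cov; have := sum_decr L ax; have := sum_decr R by0.
  have := minN _ _ cov; rewrite /bicover_weight.
  case: (x \in L); case: (y \in R) => /= ? ? ?; try by move=> _; lia.
  by move/(_ isT isT); lia.
exists ((x, y) :: s); split; rewrite /= ?ss ?rxy //.
- by move=> z; have := ca z; case: (eqVneq z x) ax => [-> /= |_ _]; rewrite ?eqxx /=; lia.
- by move=> z; have := cb z; case: (eqVneq z y) by0 => [-> /= |_ _]; rewrite ?eqxx /=; lia.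
Qed.
End Koenig.

(** * Weight ideals are integrally closed *)

Section WeightIdeal.
Import GRing.Theory.
Local Open Scope ring_scope.
Variables (K : fieldType) (n : nat) (w : 'I_n -> nat).
Local Notation S := {mpoly K[n]}.

Definition mnm_weight (m : 'X_{1..n}) : nat := (\sum_i m i * w i)%N.

Lemma mnm_weightD m m' : mnm_weight (m + m')%MM = (mnm_weight m + mnm_weight m')%N.
Proof. by rewrite -big_split; apply: eq_bigr => i _; rewrite mnmDE mulnDl. Qed.

Lemma mnm_weight1 i : mnm_weight U_(i)%MM = w i.
Proof.
rewrite /mnm_weight (bigD1 i) //= mnm1E eqxx mul1n big1 ?addn0 // => j ji.
by rewrite mnm1E eq_sym (negPf ji).
Qed.

Definition in_weight d (f : S) : Prop := forall m, m \in msupp f -> (d <= mnm_weight m)%N.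

Lemma in_weight0 d : in_weight d 0.
Proof. by move=> m; rewrite msupp0. Qed.

Lemma in_weightD d f g : in_weight d f -> in_weight d g -> in_weight d (f + g).
Proof.
by move=> Hf Hg m /msuppD_le; rewrite mem_cat => /orP[/Hf|/Hg].
Qed.

Lemma in_weight_mul d d' f g :
  in_weight d f -> in_weight d' g -> in_weight (d + d') (f * g).
Proof.
move=> Hf Hg m /msuppM_le /allpairsP[[m1 m2] /= [/Hf h1 /Hg h2 ->]].
by rewrite mnm_weightD leq_add.
Qed.

Lemma in_weightM d a f : in_weight d f -> in_weight d (a * f).
Proof. by move=> Hf; rewrite -[d]add0n; apply: in_weight_mul => // m _. Qed.

Definition weight_ideal d : ideal S := Ideal (in_weight0 d) (@in_weightD d) (@in_weightM d).

Lemma ideal_pow_weight (I : ideal S) d :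
  (forall f, I f -> weight_ideal d f) ->
  forall i f, ideal_pow I i f -> weight_ideal (d * i) f.
Proof.
move=> Id; elim=> [|i IH] f; first by move=> _ m _; rewrite muln0.
apply: gen_min => _ [g [h [/Id Ig /IH Ih ->]]].
by rewrite mulnS; apply: in_weight_mul.
Qed.

(** The substitution sending x_i to x_i t^(w i): the order in t of the image of
    f is the least weight of a monomial of f.  Keeping the x_i makes it
    injective, so that no cancellation between monomials of equal weight can
    occur. *)
Definition weight_subst : S -> {poly S} :=
  mmap ((polyC : S -> {poly S}) \o @mpolyC n K) (fun i => ('X_i : S)%:P * 'X^(w i)).

HB.instance Definition _ := GRing.RMorphism.on weight_subst.

Lemma weight_substE f :
  weight_subst f = \sum_(m <- msupp f) (f@_m *: 'X_[m] : S)%:P * 'X^(mnm_weight m).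
Proof.
apply: eq_bigr => m _ /=.
rewrite /mmap1 (eq_bigr (fun i => ('X_i ^+ m i : S)%:P * 'X^(m i * w i))); last first.
  by move=> i _; rewrite exprMn -exprM mulnC rmorphXn /=.
rewrite big_split /= -rmorph_prod /= -mpolyXE_id -expr_sum mulrA -rmorphM /=.
by rewrite mul_mpolyC.
Qed.

Lemma coef_weight_subst f m :
  (weight_subst f)`_(mnm_weight m) @_m = f@_m.
Proof.
rewrite weight_substE coef_sum raddf_sum /= [in RHS](mpolyE f) raddf_sum /=.
apply: eq_bigr => m' _; rewrite coefCM coefXn.
rewrite mcoeffZ mcoeffX; case: (eqVneq m' m) => [->|ne].
  by rewrite eqxx mulr1 mcoeffZ mcoeffX eqxx.
by rewrite mulr0 mulr_natr mcoeffMn mcoeffZ mcoeffX (negPf ne) mulr0 mul0rn.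
Qed.

Lemma weight_subst_div f d : in_weight d f -> exists q, weight_subst f = q * 'X^d.
Proof.
move=> Hf; exists (\sum_(m <- msupp f) (f@_m *: 'X_[m] : S)%:P * 'X^(mnm_weight m - d)).
rewrite weight_substE mulr_suml; apply: eq_big_seq => m /Hf le.
by rewrite -mulrA -exprD subnK.
Qed.

(** The least weight is a valuation: if f had order d0 < d in t, the leading
    term f^r of an equation of integral dependence would have order d0 r, and
    every other term a strictly larger one, so the terms could not cancel. *)
Lemma integral_closure_weight (I : ideal S) d :
  (forall f, I f -> weight_ideal d f) ->
  forall f, integral_closure I f -> weight_ideal d f.
Proof.
move=> Id f [r [c [r_gt0 Ic eq0]]] m1 m1f; rewrite leqNgt; apply/negP => lt1.
have exd : exists d0, has (fun m => mnm_weight m == d0) (msupp f).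
  by exists (mnm_weight m1); apply/hasP; exists m1.
case: (ex_minnP exd) => d0 /hasP[m mf /eqP md0] mind.
have fd0 : in_weight d0 f by move=> m' m'f; apply: mind; apply/hasP; exists m'.
have d0d : (d0 < d)%N by apply: leq_ltn_trans (fd0 _ m1f) lt1.
(* The constant coefficient of q is the part of f of weight d0, which is nonzero. *)
have [q fq] := weight_subst_div fd0.
have q0 : q`_0 != 0.
  apply/negP => /eqP q0; have := coef_weight_subst f m.
  rewrite md0 fq coefMXn ltnn subnn q0 mcoeff0 => /esym/eqP.
  by rewrite mcoeff_eq0 mf.
have /cid[u cu] : exists u : nat -> {poly S}, forall i, (1 <= i <= r)%N ->
    weight_subst (c i) = u i * 'X^(d * i).
  have H i : exists ui, (1 <= i <= r)%N -> weight_subst (c i) = ui * 'X^(d * i).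
    case: (boolP (1 <= i <= r)%N) => // ir; last by exists 0.
    have [ui Hui] := weight_subst_div (ideal_pow_weight Id (Ic i ir)).
    by exists ui.
  by exists (fun i => projT1 (cid (H i))) => i; apply: (projT2 (cid (H i))).
have : weight_subst (f ^+ r + \sum_(1 <= i < r.+1) c i * f ^+ (r - i)) = 0.
  by rewrite eq0 rmorph0.
rewrite rmorphD rmorphXn /= raddf_sum /= fq.
rewrite (eq_big_nat _ _ (F2 :=
    fun i => (u i * q ^+ (r - i) * 'X^((d - d0) * i)) * 'X^(d0 * r))); last first.
  move=> i /andP[i1 ir]; rewrite rmorphM rmorphXn /= fq cu ?i1 // exprMn -exprM.
  rewrite -!mulrA; congr (_ * _); rewrite mulrCA; congr (_ * _).
  by rewrite -!exprD; congr ('X^_); nia.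
(* After cancelling t^(d0 r), the value at t = 0 is the power q(0)^r. *)
rewrite -mulr_suml exprMn -exprM -mulrDl => /eqP.
rewrite mulf_eq0 => /orP[/eqP|]; last by rewrite expf_eq0 polyX_eq0 andbF.
move/(congr1 (fun p : {poly S} => p.[0])).
rewrite horner0 hornerD horner_exp horner_sum big1_seq ?addr0.
  by move/eqP; rewrite expf_eq0 r_gt0 /= horner_coef0 (negPf q0).
move=> i; rewrite mem_index_iota => /andP[_ /andP[i1 _]].
rewrite hornerM hornerXn expr0n muln_eq0 subn_eq0 leqNgt d0d /=.
by case: i i1 => //= i _; rewrite mulr0.
Qed.
End WeightIdeal.

(** * The monomials of the integral closure of a power of an edge ideal *)

Section Covers.
Import GRing.Theory.
Local Open Scope ring_scope.
Variables (n : nat) (e : rel 'I_n) (e_sym : symmetric e).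
Implicit Types (P : {set 'I_n} * {set 'I_n}) (c : 'I_n -> nat) (C : {set 'I_n}).

(** A pair (L, R) of vertex sets covering the bipartite double cover of the
    graph, whose edges join the left copy of u to the right copy of v whenever
    uv is an edge.  Counting a vertex once for L and once for R turns such a
    pair into a half-integral vertex cover of the graph, with values doubled. *)
Definition dcover P : bool := bicover e P.1 P.2.
Definition cmult P (v : 'I_n) : nat := ((v \in P.1) + (v \in P.2))%N.
Definition cweight C c P : nat := (\sum_(v in C) c v * cmult P v)%N.
(** By linear programming duality, this says that the fractional matching number
    of the graph with capacities c is at least k. *)
Definition heavy k c : bool := [forall P, dcover P ==> (2 * k <= cweight [set: 'I_n] c P)%N].

Lemma heavyP k c :
  reflect (forall P, dcover P -> (2 * k <= cweight [set: 'I_n] c P)%N) (heavy k c).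
Proof. by apply: (iffP forallP) => H P; [apply/implyP/H|apply/implyP/H]. Qed.

Lemma cweight_setT c P : cweight [set: 'I_n] c P = bicover_weight c c P.1 P.2.
Proof.
rewrite /cweight /bicover_weight [X in _ = (X + _)%N]big_mkcond [X in _ = (_ + X)%N]big_mkcond.
rewrite -big_split; apply: eq_big => [v|v _]; first by rewrite inE.
by rewrite mulnDr /=; case: (v \in P.1); case: (v \in P.2); rewrite ?muln0 ?muln1.
Qed.

Variable K : fieldType.
Local Notation S := {mpoly K[n]}.
Local Notation J k := (integral_closure (ideal_pow (edge_ideal e K) k)).

Lemma ideal_pow_edges (s : seq ('I_n * 'I_n)) :
  all (fun p => e p.1 p.2) s ->
  ideal_pow (edge_ideal e K) (size s) 'X_[\big[mnm_add/0%MM]_(p <- s) (U_(p.1) + U_(p.2))%MM].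
Proof.
elim: s => [|p s IH] /=; first by move=> _; exact: (@ideal_pow0 _ (edge_ideal e K)).
case/andP=> ep es; rewrite big_cons mpolyXD.
apply: gen_sub; exists 'X_[(U_(p.1) + U_(p.2))%MM].
exists 'X_[\big[mnm_add/0%MM]_(p <- s) (U_(p.1) + U_(p.2))%MM]; split; [|exact: IH|by []].
by apply: gen_sub; exists p.1, p.2; rewrite mpolyXD.
Qed.

Lemma square_integral (I : ideal S) f : ideal_pow I 2 (f ^+ 2) -> integral_closure I f.
Proof.
move=> If; exists 2, (fun i => if i == 2 then - f ^+ 2 else 0); split=> // [i|].
  by case: i => [|[|[|i]]] //= _; [exact: (ideal0 (ideal_pow I 1))|exact: (idealN (I :=
      ideal_pow I 2))].
by rewrite big_nat_recl // big_nat1 /= mul0r add0r subnn mulr1 subrr.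
Qed.

Lemma ideal_pow_sub (I : ideal S) k f g :
  ideal_pow I k f -> ideal_pow I k g -> ideal_pow (ideal_pow I k) 2 (f * g).
Proof.
move=> If Ig; apply: gen_sub; exists f, g; split=> //.
apply: gen_sub; exists g, 1; split; rewrite ?mulr1 //.
exact: gen_sub.
Qed.

Lemma sum_bool_count (T : Type) (a : pred T) (s : seq T) :
  (\sum_(x <- s) (a x : nat) = count a s)%N.
Proof. by elim: s => [|x s IH] /=; rewrite ?big_nil ?big_cons ?IH. Qed.

(** Koenig's theorem with capacities m on both sides gives 2k edges whose product
    divides the square of the monomial, so this square lies in the square of
    I^k. *)
Lemma heavy_mem k (m : 'X_{1..n}) : heavy k m -> J k 'X_[m].
Proof.
move=> /heavyP Hm.
have [L R cov|s [ss es ca cb]] := @koenig _ _ e (fun v => m v) (fun v => m v) (2 * k).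
  by have := Hm (L, R) cov; rewrite cweight_setT.
apply: square_integral.
pose E s := \big[mnm_add/0%MM]_(p <- s) (U_(p.1) + U_(p.2) : 'X_{1..n})%MM.
have le : (E s <= m *+ 2)%MM.
  apply/mnm_lepP => v; rewrite mulmnE mnm_sumE.
  rewrite (eq_bigr (fun p => (p.1 == v) + (p.2 == v))%N) => [|p _]; last first.
    by rewrite mnmDE !mnm1E.
  rewrite big_split /= mulnC mul2n -addnn.
  by apply: leq_add; rewrite sum_bool_count.
rewrite mpolyXn -(submK le) mpolyXD; apply: idealM.
have : E s = (E (take k s) + E (drop k s))%MM by rewrite /E -big_cat cat_take_drop.
move=> ->; rewrite mpolyXD; apply: ideal_pow_sub.
  have st : size (take k s) = k by rewrite size_takel // ss; lia.
  rewrite -[X in ideal_pow _ X]st; apply: ideal_pow_edges.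
  by apply/allP => x /mem_take; move/allP: es; apply.
have sd : size (drop k s) = k by rewrite size_drop ss; lia.
rewrite -[X in ideal_pow _ X]sd; apply: ideal_pow_edges.
by apply/allP => x /mem_drop; move/allP: es; apply.
Qed.

(** For each cover P, the weight [cmult P] is at least 2 on every edge, hence at
    least 2k on I^k, and this bound passes to the integral closure. *)
Theorem closure_heavy k f :
  J k f <-> forall m : 'X_{1..n}, m \in msupp f -> heavy k m.
Proof.
split=> [Jf m mf|Hf].
  apply/heavyP => P /bicoverP Pc.
  have Iw g : ideal_pow (edge_ideal e K) k g -> weight_ideal K (cmult P) (2 * k) g.
    apply: ideal_pow_weight; apply: gen_min => _ [i [j [eij ->]]] u.
    rewrite -mpolyXD => /mem_msuppXP <-; rewrite mnm_weightD !mnm_weight1 /cmult.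
    have := Pc _ _ eij; have := Pc j i; rewrite e_sym eij => /(_ isT).
    by case: (i \in P.1); case: (i \in P.2); case: (j \in P.1); case: (j \in P.2).
  have := integral_closure_weight Iw Jf mf.
  by rewrite /cweight [in X in _ -> X](eq_bigl predT) => [|v]; rewrite ?inE.
rewrite (mpolyE f) big_seq; apply: ideal_sum => m mf.
by rewrite -mul_mpolyC; apply/idealM/heavy_mem/Hf.
Qed.
End Covers.

(** * Stanley decompositions from partitions of exponents *)

Section Enat.
Lemma lee_trans a b c : lee a b -> lee b c -> lee a c.
Proof. by case: a b c => [a|] [b|] [c|] //=; exact: leq_trans. Qed.

Lemma lee_refl a : lee a a.
Proof. by case: a => /=. Qed.

Lemma lee_supe (A : enat -> Prop) a : A a -> lee a (supe A).
Proof. by move: a; apply/supe_lub/lee_refl. Qed.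

Lemma lee_bigmine (I : finType) (s : enat) (F : I -> enat) :
  (forall i, lee s (F i)) -> lee s (\big[mine/Inf]_i F i).
Proof.
move=> sF; elim/big_rec: _ => [|i x _ sx]; first by case: s {sF}.
by rewrite /mine; case: ifP.
Qed.
End Enat.

Section StanleyCells.
Import GRing.Theory.
Local Open Scope ring_scope.
Variables (K : fieldType) (n : nat) (J : ideal {mpoly K[n]}) (in_expo : 'X_{1..n} -> bool).
Hypothesis JE : forall f, J f <-> forall m, m \in msupp f -> in_expo m.
Variables (T : finType) (base : T -> 'X_{1..n}) (Z : T -> {set 'I_n}).

(** The exponents of the monomials in the Stanley space spanned over K[Z t] by the
    monomial of exponent [base t]. *)
Definition in_cell t (m : 'X_{1..n}) : bool :=
  (base t <= m)%MM && [forall i, (i \notin Z t) ==> (m i == base t i)].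

Hypothesis cell_outside : forall t m, in_cell t m -> ~~ in_expo m.
Hypothesis cell_cover : forall m, ~~ in_expo m -> exists t, in_cell t m.
Hypothesis cell_disj : forall t t' m, in_cell t m -> in_cell t' m -> t = t'.

Lemma quot_pi_eq0 f : quot_pi J f = 0 <-> J f.
Proof.
have -> : 0 = quot_pi J 0 by have := quot_piD J 0 0; rewrite addr0 -[LHS]addr0 => /addrI.
by rewrite quot_piP subr0.
Qed.

Lemma quot_pi_sum (I : Type) (s : seq I) (P : pred I) (F : I -> {mpoly K[n]}) :
  quot_pi J (\sum_(i <- s | P i) F i) = \sum_(i <- s | P i) quot_pi J (F i).
Proof. by apply: big_morph; [exact: quot_piD|apply/quot_pi_eq0; exact: ideal0]. Qed.

Lemma msupp_cell t f (m : 'X_{1..n}) : in_vars (Z t) (f : {mpoly K[n]}) ->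
    m \in msupp (f * 'X_[base t]) -> in_cell t m.
Proof.
move=> fZ /msuppM_le /allpairsP[[m1 m2] /= [m1f /mem_msuppXP <- ->]].
apply/andP; split; first exact: lem_addl.
by apply/forallP => i; apply/implyP => iZ; rewrite mnmDE (fZ _ m1f _ iZ).
Qed.

(** This is the freeness of a Stanley space. *)
Lemma cell_component t (f : {mpoly K[n]}) :
  in_vars (Z t) f -> J (f * 'X_[base t]) -> f = 0.
Proof.
move=> fZ /JE Jf; apply/eqP; rewrite -msupp_eq0; apply/eqP.
case E: (msupp f) => [//|m1 s].
have m1f : m1 \in msupp f by rewrite E mem_head.
have mf : (base t + m1)%MM \in msupp (f * 'X_[base t]).
  by rewrite mcoeff_msupp mcoeffMX -mcoeff_msupp.
by have := cell_outside (msupp_cell fZ mf); rewrite Jf.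
Qed.

Lemma mcoeff_restrict (g : {mpoly K[n]}) (P : pred 'X_{1..n}) m :
  (\sum_(m' <- msupp g | P m') g@_m' *: 'X_[m'])@_m = if P m then g@_m else 0.
Proof.
rewrite raddf_sum /= big_mkcond /=.
rewrite (eq_bigr (fun m' => if m' == m then if P m then g@_m else 0 else 0)); last first.
  move=> m' _; rewrite mcoeffZ mcoeffX; case: eqP => [->|_]; first by rewrite mulr1.
  by rewrite mulr0; case: ifP.
rewrite -big_mkcond; case: (boolP (m \in msupp g)) => mg.
  rewrite -big_filter (_ : [seq _ <- _ | _] = [:: m]) ?big_seq1 //.
  by apply: filter_pred1_uniq => //; exact: msupp_uniq.
by rewrite memN_msupp_eq0 // if_same big1.
Qed.

(** The monomials outside J form a basis of S / J, so a finite partition of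
    their exponents into cells is a Stanley decomposition. *)
Lemma stanley_cells :
  stanley_decomposition (@quot_hom K n J)
    (fun i : 'I_#|T| => quot_pi J 'X_[base (enum_val i)]) (fun i => Z (enum_val i)).
Proof.
split=> [i|w|v vS v0 i].
- split; first by exists 1, (base (enum_val i)); rewrite scale1r.
  move=> f fZ; rewrite quot_piZ => /quot_pi_eq0; exact: cell_component.
- set g := quot_repr w.
  pose gt t := \sum_(m <- msupp g | in_cell t m) g@_m *: 'X_[(m - base t)%MM].
  have gtE t m : (gt t * 'X_[base t])@_m = if in_cell t m then g@_m else 0.
    rewrite -mcoeff_restrict mulr_suml; congr (_ @_ _); apply: eq_bigr => m' /andP[le _].
    by rewrite -scalerAl -mpolyXD submK.
  exists (fun i => gt (enum_val i) *: quot_pi J 'X_[base (enum_val i)]); split.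
    move=> i; exists (gt (enum_val i)) => // m; set t := enum_val i.
    rewrite mcoeff_msupp -(mcoeffMX _ (base t)) gtE.
    case: ifP => [/andP[_ /forallP c] _ j jZ|]; last by rewrite eqxx.
    by have := c j; rewrite jZ mnmDE /= => /eqP; lia.
  rewrite (eq_bigr (fun i => quot_pi J (gt (enum_val i) * 'X_[base (enum_val i)]))); last first.
    by move=> i _; rewrite quot_piZ.
  rewrite -quot_pi_sum -[w]quot_reprK -/g; apply/quot_piP.
  rewrite -(big_enum_val (A := T) (fun t => gt t * 'X_[base t])) /=.
  apply/JE => m; rewrite mcoeff_msupp mcoeffB raddf_sum /=.
  apply: contraR => /cell_cover[t tm]; rewrite (bigD1 t) //= gtE tm big1 ?addr0 ?subrr //.
  move=> t' tt'; rewrite gtE; case: ifP => // t'm.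
  by rewrite (cell_disj tm t'm) eqxx in tt'.
- have /choice[f Hf] : forall i, exists f, in_vars (Z (enum_val i)) f /\
      v i = quot_pi J (f * 'X_[base (enum_val i)]).
    by move=> j; have [f fZ ->] := vS j; exists f; rewrite quot_piZ.
  pose F j := f j * 'X_[base (enum_val j)].
  have JF : J (\sum_j F j).
    apply/quot_pi_eq0; rewrite quot_pi_sum -[RHS]v0; apply: eq_bigr => j _.
    by case: (Hf j).
  case: (Hf i) => fZ ->; apply/quot_pi_eq0; apply/JE => m mF.
  have im := msupp_cell fZ mF.
  move/JE: JF => /(_ m); apply;
      rewrite mcoeff_msupp raddf_sum (bigD1 i) //= big1 ?addr0 -?mcoeff_msupp //.
  move=> j ji; apply: memN_msupp_eq0; apply: contra ji => mj.
  by apply/eqP/enum_val_inj; apply: cell_disj im; apply: msupp_cell mj; case: (Hf j).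
Qed.

Lemma sdepth_cells p : (forall t, (p <= #|Z t|)%N) -> lee (Fin p) (sdepth_quot J).
Proof.
move=> pZ; apply: (@lee_trans _ (\big[mine/Inf]_(i < #|T|) Fin #|Z (enum_val i)|)).
  by apply: lee_bigmine => i; apply: pZ.
by apply: lee_supe; exists #|T|, (fun i => quot_pi J 'X_[base (enum_val i)]),
    (fun i => Z (enum_val i)); split => //; exact: stanley_cells.
Qed.
End StanleyCells.

(** * Free directions of an exponent *)

Section Components.
Variables (n : nat) (e : rel 'I_n).
Hypotheses (e_sym : symmetric e) (e_irr : irreflexive e).
Implicit Types (P : {set 'I_n} * {set 'I_n}) (c : 'I_n -> nat) (C : {set 'I_n}).
Local Notation dcover := (dcover e).

Definition component (v : 'I_n) : {set 'I_n} := [set u in [set: 'I_n] | connect e v u].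

Lemma mem_component u v : (u \in component v) = connect e v u.
Proof. by rewrite !inE. Qed.

Lemma component_refl v : v \in component v.
Proof. by rewrite mem_component. Qed.

Lemma connectC : connect_sym e.
Proof. exact: sym_connect_sym. Qed.

Lemma component_eq u v : u \in component v -> component u = component v.
Proof.
rewrite mem_component => uv; apply/setP => z; rewrite !mem_component.
by rewrite (same_connect connectC uv).
Qed.

Lemma component_edge u v : e u v -> component u = component v.
Proof. by move=> uv; apply/esym/component_eq; rewrite mem_component connect1. Qed.

Lemma component_step x u v : u \in component x -> e u v -> v \in component x.
Proof.
by move=> ux uv; rewrite -(component_eq ux) (component_edge uv) component_refl.
Qed.

Lemma bipartite_side x : bipartite e (component x) ->
  exists A : {set 'I_n},
    forall u v, u \in component x -> e u v -> (u \in A) != (v \in A).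
Proof.
case/existsP => A /forall_inP bipA; exists A => u v ux uv.
by have /forall_inP/(_ v (component_step ux uv)) := bipA u ux; rewrite uv.
Qed.

Lemma componentsP C : reflect (exists v, C = component v) (C \in components e).
Proof.
apply: (iffP imsetP) => [[v _ ->]|[v ->]]; exists v => //.
Qed.

Lemma dcoverP P :
  reflect (forall u v, e u v -> (u \in P.1) || (v \in P.2)) (dcover P).
Proof. exact: bicoverP. Qed.

(** Edges stay inside components, so covers chosen independently on each
    component fit together. *)
Definition glue (Q : 'I_n -> {set 'I_n} * {set 'I_n}) : {set 'I_n} * {set 'I_n} :=
  ([set v | v \in (Q v).1], [set v | v \in (Q v).2]).

Lemma cmult_glue Q v : cmult (glue Q) v = cmult (Q v) v.
Proof. by rewrite /cmult !inE. Qed.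

Lemma cover_glue Q :
  (forall v, dcover (Q v)) -> (forall u v, e u v -> Q u = Q v) -> dcover (glue Q).
Proof.
move=> Qc Qe; apply/dcoverP => u v uv; rewrite !inE -(Qe _ _ uv).
by apply: (dcoverP _ (Qc u)).
Qed.

Lemma cweight_ext C c c' P : {in C, c =1 c'} -> cweight C c P = cweight C c' P.
Proof. by move=> cc; apply: eq_bigr => v /cc ->. Qed.

Lemma cweight_le C c c' P : {in C, forall v, c v <= c' v} -> cweight C c P <= cweight C c' P.
Proof. by move=> cc; apply: leq_sum => v /cc le; rewrite leq_mul2r le orbT. Qed.

Lemma cweight_partition c P : cweight [set: 'I_n] c P = \sum_(C in components e) cweight C c P.
Proof.
rewrite /cweight (partition_big component (mem (components e))) /=; last first.
  by move=> v _; apply/componentsP; exists v.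
apply: eq_bigr => C /componentsP[x ->]; apply: eq_bigl => v; rewrite inE /=.
by apply/eqP/idP => [<-|/component_eq //]; exact: component_refl.
Qed.

Definition optimal C c P : bool :=
  dcover P && [forall P', dcover P' ==> (cweight C c P <= cweight C c P')].

Lemma optimalP C c P :
  reflect (dcover P /\ forall P', dcover P' -> cweight C c P <= cweight C c P') (optimal C c P).
Proof.
apply: (iffP andP) => -[cP H]; split=> //.
  move=> P' cP'; by have /forallP/(_ P')/implyP := H; apply.
by apply/forallP => P'; apply/implyP/H.
Qed.

Lemma optimal_exists C c : exists P, optimal C c P.
Proof.
have c0 : dcover (setT, setT) by apply/dcoverP => u v _; rewrite inE.
case: (arg_minnP (fun P => cweight C c P) c0) => P cP minP.
by exists P; apply/optimalP.
Qed.

Lemma optimal_le C c P P' : optimal C c P -> dcover P' -> cweight C c P' <= cweight C c P ->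
    optimal C c P'.
Proof.
move=> /optimalP[cP minP] cP' le; apply/optimalP; split=> // Q cQ.
exact: leq_trans le (minP _ cQ).
Qed.

(** If a cover of least weight on C avoids v, increasing c at v does not change
    that least weight. *)
Definition free C c v : bool :=
  (v \in C) && [exists P, optimal C c P && (cmult P v == 0)].

Lemma freeP C c v :
  reflect (v \in C /\ exists2 P, optimal C c P & cmult P v = 0) (free C c v).
Proof.
apply: (iffP andP) => -[vC H]; split=> //.
  by case/existsP: H => P /andP[oP /eqP mP]; exists P.
by case: H => P oP mP; apply/existsP; exists P; rewrite oP mP.
Qed.

(** When both parts of the cover agree on the component, they form a vertex
    cover of it; such a cover either misses a vertex or remains a cover after one
    vertex is removed, as there are no loops. *)
Lemma free_symmetric_cover x c P :
  optimal (component x) c P -> {in component x, forall v, (v \in P.1) = (v \in P.2)} ->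
  exists v, free (component x) c v.
Proof.
move=> oP symP; have [cP _] := optimalP _ _ _ oP.
case: (boolP [exists v in component x, v \notin P.1]) => [/exists_inP[v vC vP]|].
  exists v; apply/freeP; split=> //; exists P => //.
  by rewrite /cmult -symP // (negPf vP).
rewrite negb_exists_in => /forall_inP allP.
have inP v : v \in component x -> (v \in P.1) && (v \in P.2).
  by move=> vC; rewrite -symP // andbb; apply: contraR (allP v vC).
exists x; apply/freeP; split; first exact: component_refl.
exists (P.1 :\ x, P.2 :\ x); last by rewrite /cmult !inE eqxx.
apply: optimal_le oP _ _.
  apply/dcoverP => u v uv; rewrite !inE.
  case: (eqVneq u x) uv => [->|ux] uv /=.
    have /inP/andP[_ ->] : v \in component x by rewrite mem_component connect1.
    by rewrite andbT; apply: contraTneq uv => ->; rewrite e_irr.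
  case: (eqVneq v x) uv => [->|vx] uv /=; last exact: (dcoverP _ cP).
  rewrite orbF; have /inP/andP[-> _] // : u \in component x.
  by rewrite mem_component connectC connect1.
by apply: leq_sum => v _; rewrite leq_mul2l /cmult !inE; case: (v == x);
    rewrite ?orbT // leqnn orbT.
Qed.

(** On a bipartite component with sides A and B, an optimal cover (L, R) splits
    into the vertex covers (L n A) U (R n B) and (L n B) U (R n A), each used as
    both parts of a pair.  The weights of these two pairs add up to twice that of
    (L, R), so one of them is optimal as well, and [free_symmetric_cover]
    applies. *)
Lemma free_exists x c : bipartite e (component x) -> exists v, free (component x) c v.
Proof.
move=> /bipartite_side[A bipA].
have [P oP] := optimal_exists (component x) c; have [cP _] := optimalP _ _ _ oP.
pose D (B : {set 'I_n}) := [set v | if v \in B then v \in P.1 else v \in P.2].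
pose PD (B : {set 'I_n}) := glue (fun v => if v \in component x then (D B, D B) else P).
have cD (B : {set 'I_n}) : (forall u v, u \in component x -> e u v ->
    (u \in B) != (v \in B)) -> dcover (PD B).
  move=> HB; apply/dcoverP => u v uv; rewrite !inE.
  have -> : connect e x v = connect e x u.
    by apply: (same_connect_r connectC); rewrite connectC connect1.
  case: ifP => uC; last exact: (dcoverP _ cP).
  rewrite -mem_component in uC.
  have := HB _ _ uC uv; have := dcoverP _ cP _ _ uv.
  have := dcoverP _ cP v u; rewrite e_sym uv => /(_ isT); rewrite !inE.
  by case: (u \in B); case: (v \in B) => //; rewrite orbC.
have cA := cD A bipA.
have cA' : dcover (PD (~: A)).
  by apply: cD => u v uC uv; have := bipA _ _ uC uv; rewrite !inE; case: (u \in A);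
      case: (v \in A).
have sum2 : cweight (component x) c (PD A) + cweight (component x) c (PD (~: A)) =
    cweight (component x) c P + cweight (component x) c P.
  rewrite /cweight -!big_split; apply: eq_bigr => v vC /=; rewrite -!mulnDr; congr (_ * _).
  rewrite !cmult_glue vC /cmult /D /= !inE; case: (v \in A) => /=;
    by case: (v \in P.1); case: (v \in P.2).
have fin B : optimal (component x) c (PD B) -> exists v, free (component x) c v.
  by move=> /free_symmetric_cover; apply => v; rewrite mem_component !inE => ->.
(* One of the two covers weighs at most the average, that is, at most P. *)
case: (leqP (cweight (component x) c (PD A)) (cweight (component x) c P)) => le.
  by apply: (fin A); apply: optimal_le oP cA le.
by apply: (fin (~: A)); apply: optimal_le oP cA' _; lia.
Qed.

(** Taking the least free vertex of a component makes the choice stable: moving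
    along the chosen direction never creates a smaller free vertex. *)
Definition is_direction c v : bool :=
  free (component v) c v && [forall u, free (component v) c u ==> (v <= u)].

Lemma is_directionP c v :
  reflect (free (component v) c v /\ forall u, free (component v) c u ->
      v <= u) (is_direction c v).
Proof.
apply: (iffP andP) => -[fv H]; split=> //.
  move=> u fu; by have /forallP/(_ u)/implyP := H; apply.
by apply/forallP => u; apply/implyP/H.
Qed.

Lemma is_direction_uniq c u v : u \in component v -> is_direction c u -> is_direction c v ->
    u = v.
Proof.
move=> uv /is_directionP[fu mu] /is_directionP[fv mv]; rewrite (component_eq uv) in fu mu.
by apply/val_inj/eqP; rewrite eqn_leq mu // mv.
Qed.

Lemma is_direction_exists x c : bipartite e (component x) -> exists2 v, v \in component x &
    is_direction c v.
Proof.
move=> /(free_exists c) [v0 fv0].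
case: (arg_minnP (fun v : 'I_n => val v) fv0) => v fv minv.
have vx : v \in component x by case/andP: fv.
by exists v => //; apply/is_directionP; rewrite (component_eq vx); split.
Qed.

Lemma optimal_ext C c c' P : {in C, c =1 c'} -> optimal C c P = optimal C c' P.
Proof.
move=> cc; congr (_ && _); apply: eq_forallb => P'.
by rewrite !(cweight_ext _ cc).
Qed.

Lemma free_ext C c c' v : {in C, c =1 c'} -> free C c v = free C c' v.
Proof.
by move=> cc; congr (_ && _); apply: eq_existsb => P; rewrite (optimal_ext _ cc).
Qed.

Lemma is_direction_ext c c' v : {in component v, c =1 c'} -> is_direction c v =
    is_direction c' v.
Proof.
move=> cc; rewrite /is_direction (free_ext _ cc); congr (_ && _).
by apply: eq_forallb => u; rewrite (free_ext _ cc).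
Qed.

(** A cover optimal at c that avoids v stays optimal when c increases at v only.
    Hence the minimal weight does not change, and a vertex free at c' is already
    free at c. *)
Lemma is_direction_up c c' v :
  {in component v, forall u, u != v -> c u = c' u} -> c v <= c' v -> is_direction c v ->
      is_direction c' v.
Proof.
move=> cc cv /is_directionP[/freeP[vC [P oP mP]] minv].
have [cP minP] := optimalP _ _ _ oP.
have wP : cweight (component v) c P = cweight (component v) c' P.
  apply: eq_bigr => u uC; case: (eqVneq u v) => [->|uv]; first by rewrite mP !muln0.
  by rewrite cc.
have cle : {in component v, forall u, c u <= c' u}.
  by move=> u uC; case: (eqVneq u v) => [->|uv] //; rewrite cc.
have oP' : optimal (component v) c' P.
  apply/optimalP; split=> // P' cP'; rewrite -wP.
  exact: leq_trans (minP _ cP') (cweight_le _ cle).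
apply/is_directionP; split=> [|u /freeP[uC [Q oQ mQ]]]; first by apply/freeP; split=> //;
    exists P.
apply: minv; apply/freeP; split=> //; exists Q => //.
have [cQ minQ] := optimalP _ _ _ oQ.
apply: optimal_le oP cQ _; rewrite wP; apply: leq_trans (cweight_le _ cle) _.
exact: minQ.
Qed.

Definition directions c : {set 'I_n} := [set v | bipartite e (component v) && is_direction c v].

Lemma card_directions c : num_bipartite_components e <= #|directions c|.
Proof.
apply: leq_trans (leq_imset_card component (directions c)); apply: subset_leq_card.
apply/subsetP => C; rewrite inE => /andP[/componentsP[x ->] bx].
have [v vx dv] := is_direction_exists c bx; apply/imsetP; exists v;
    last by rewrite (component_eq vx).
by rewrite inE (component_eq vx) bx.
Qed.

Lemma directions_uniq c u v : u \in component v -> u \in directions c ->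
    v \in directions c -> u = v.
Proof.
by move=> uv; rewrite [u \in _]inE [v \in _]inE => /andP[_ du] /andP[_];
    apply: is_direction_uniq.
Qed.

Lemma directions_sub_eq c c' : directions c \subset directions c' -> directions c =
    directions c'.
Proof.
move=> sub; apply/eqP; rewrite eqEsubset sub; apply/subsetP => v v'.
have bv : bipartite e (component v) by move: v'; rewrite inE => /andP[].
have [u uv du] := is_direction_exists c bv.
have uc : u \in directions c by rewrite inE (component_eq uv) bv.
by rewrite -(directions_uniq uv (subsetP sub _ uc) v').
Qed.

Definition above c c' : Prop :=
  (forall v, c v <= c' v) /\ forall v, v \notin directions c -> c' v = c v.

Lemma directions_above c c' : above c c' -> directions c' = directions c.
Proof.
move=> [le eq]; apply/esym/directions_sub_eq/subsetP => v vc.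
have [bv dv] : bipartite e (component v) /\ is_direction c v by apply/andP; rewrite inE in vc.
rewrite inE bv; apply: is_direction_up dv => // u uC uv.
by rewrite eq //; apply: contra uv => uc; apply/eqP/(directions_uniq uC uc vc).
Qed.

(** Gluing optimal covers that avoid the chosen directions gives a cover of least
    weight at c on each component, and its weight is the same at c' as at c. *)
Lemma heavy_above k c c' : above c c' -> heavy e k c' -> heavy e k c.
Proof.
move=> [le eq] /heavyP H; apply/heavyP => P cP.
have /choice[Q HQ] : forall C, exists Q, optimal C c Q /\
    forall v, v \in directions c -> component v = C -> cmult Q v = 0.
  move=> C; case: (boolP [exists v in directions c,
      component v == C]) => [/exists_inP[v vc /eqP vC]|].
    have := vc; rewrite inE => /andP[_ /is_directionP[/freeP[_ [Q oQ mQ]] _]].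
    exists Q; split=> [|u uc uC]; first by rewrite -vC.
    by rewrite (directions_uniq _ uc vc) // vC -uC component_refl.
  rewrite negb_exists_in => /forall_inP none; have [Q oQ] := optimal_exists C c.
  by exists Q; split=> // v vc vC; have := none v vc; rewrite vC eqxx.
pose G := glue (Q \o component).
have cG : dcover G.
  apply: cover_glue => [v|u v uv] /=; first by have [/optimalP[]] := HQ (component v).
  by rewrite (component_edge uv).
apply: leq_trans (H _ cG) _.
have -> : cweight [set: 'I_n] c' G = cweight [set: 'I_n] c G.
  apply: eq_bigr => v _; case: (boolP (v \in directions c)) => vc; last by rewrite eq.
  by rewrite cmult_glue /=; have [_ ->] := HQ (component v); rewrite ?muln0.
rewrite !cweight_partition; apply: leq_sum => C /componentsP[x ->].
have -> : cweight (component x) c G = cweight (component x) c (Q (component x)).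
  by apply: eq_bigr => v vx; rewrite cmult_glue /= (component_eq vx).
by have [/optimalP[_ minQ] _] := HQ (component x); apply: minQ.
Qed.

Lemma heavy_le k c c' : (forall v, c v <= c' v) -> heavy e k c -> heavy e k c'.
Proof.
move=> le /heavyP H; apply/heavyP => P /H; move/leq_trans; apply.
exact: cweight_le.
Qed.

(** A vertex used by a cover with capacity beyond 2k already gives it weight 2k;
    this truncation is what makes the decomposition finite. *)
Lemma heavy_clamp k c : heavy e k c -> heavy e k (fun v => minn (c v) (2 * k)).
Proof.
move=> /heavyP H; apply/heavyP => P cP.
case: (boolP [exists v, (0 < cmult P v) && (2 * k < c v)]) => [/existsP[v /andP[mv cv]]|].
  rewrite /cweight (bigD1 v) ?inE //= (minn_idPr (ltnW cv)).
  by apply: leq_trans (leq_addr _ _); apply: leq_pmulr.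
rewrite negb_exists => /forallP small; apply: leq_trans (H _ cP) _.
rewrite leq_eqVlt; apply/orP; left; apply/eqP; apply: eq_bigr => v _.
have := small v; case: (posnP (cmult P v)) => [->|_] /=; first by rewrite !muln0.
by rewrite -leqNgt => /minn_idPl ->.
Qed.
End Components.

(** * The Stanley cells *)

Section Cells.
Variables (n : nat) (e : rel 'I_n).
Hypotheses (e_sym : symmetric e) (e_irr : irreflexive e).
Variable k : nat.
Local Notation g := (2 * k).
Local Notation box := {ffun 'I_n -> 'I_g.+1}.
Implicit Types (c : 'I_n -> nat) (s : box).
Local Notation directions := (directions e).
Local Notation is_direction := (is_direction e).
Local Notation component := (component e).

Definition clamp c v := minn (c v) g.
Definition box_val s : 'I_n -> nat := fun v => s v.
Definition update c v t : 'I_n -> nat := fun u => if u == v then t else c u.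

(** The corner of a cell: lowering a coordinate in one of the chosen directions
    changes the direction chosen in that component, so the corner is the least
    point of its cell. *)
Definition corner s : bool :=
  ~~ heavy e k (box_val s) &&
  [forall v in directions (box_val s), forall t : 'I_g.+1,
      (t < s v) ==> ~~ is_direction (update (box_val s) v t) v].

Definition cell_index := {s : box | corner s}.

Definition cell_base (t : cell_index) : 'X_{1..n} := [multinom (val t i : nat) | i < n].
(** A coordinate equal to the truncation bound 2k stands for all larger values,
    so it is a free direction as well. *)
Definition cell_directions (t : cell_index) : {set 'I_n} :=
  directions (box_val (val t)) :|: [set v | val t v == g :> nat].

Lemma in_cellE (t : cell_index) (m : 'X_{1..n}) :
  in_cell cell_base cell_directions t m <-> above e (box_val (val t)) (clamp m).
Proof.
have sg v : box_val (val t) v <= g by rewrite /box_val -ltnS ltn_ord.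
split=> [/andP[/mnm_lepP le /forallP eqm]|[le eqc]].
  have {}le v : box_val (val t) v <= m v by have := le v; rewrite mnmE.
  split=> v; first by rewrite /clamp leq_min le sg.
  move=> vd; rewrite /clamp; have := sg v; have := le v; have := eqm v.
  rewrite /cell_directions in_setU (negPf vd) in_set /= mnmE -/(box_val _ v).
  by case: eqP => [-> _ /minn_idPr //|_ /= /eqP -> _ /minn_idPl].
have lem v : box_val (val t) v <= m v by apply: leq_trans (le v) _; exact: geq_minl.
apply/andP; split; first by apply/mnm_lepP => v; rewrite mnmE; exact: lem.
apply/forallP => v; apply/implyP; rewrite /cell_directions in_setU negb_or => /andP[vd];
    rewrite in_set => vg.
have := eqc v vd; rewrite /clamp mnmE -/(box_val _ v) => E; apply/eqP.
by move: vg; rewrite -/(box_val _ v) -E; have := sg v; lia.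
Qed.

(** Points above a corner have the same directions as the corner, so two corners
    below a common point can differ only along these directions; there,
    minimality of both corners forces equality, since each component contains
    only one direction. *)
Lemma cell_disj (t t' : cell_index) m :
  in_cell cell_base cell_directions t m -> in_cell cell_base cell_directions t' m -> t = t'.
Proof.
have half (s s' : box) : corner s' -> above e (box_val s) (clamp m) ->
    above e (box_val s') (clamp m) ->
    forall v, s' v <= s v.
  move=> /andP[_ /forall_inP Hs'] ab ab' v; rewrite leqNgt; apply/negP => lt.
  have dd : directions (box_val s) = directions (box_val s').
    by rewrite -(directions_above e_sym e_irr ab) (directions_above e_sym e_irr ab').
  case: (boolP (v \in directions (box_val s))) => vd; last first.
    move: lt; rewrite -/(box_val s v) -/(box_val s' v).
    by rewrite -(proj2 ab v vd) -(proj2 ab' v) ?ltnn // -dd.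
  have vd' := vd; rewrite dd in vd'.
  have := Hs' v vd' => /forallP/(_ (s v)); rewrite lt /= => /negP; apply.
  have : is_direction (box_val s) v by move: vd; rewrite inE => /andP[].
  rewrite (is_direction_ext (c' := update (box_val s') v (s v))) // => u uv.
  rewrite /update; case: eqP => [->//|/eqP ne].
  have ud : u \notin directions (box_val s).
    by apply: contra ne => ud; apply/eqP/(directions_uniq e_sym uv ud vd).
  by rewrite -(proj2 ab u ud) -(proj2 ab' u) // -dd.
move=> /in_cellE ab /in_cellE ab'; apply/val_inj/ffunP => v; apply/val_inj/eqP.
by rewrite eqn_leq (half _ _ (valP t) ab' ab) (half _ _ (valP t') ab ab').
Qed.

Lemma cell_outside (t : cell_index) (m : 'X_{1..n}) :
  in_cell cell_base cell_directions t m -> ~~ heavy e k m.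
Proof.
move=> /in_cellE ab; have /andP[nh _] := valP t.
by apply: contra nh => /heavy_clamp; apply: heavy_above.
Qed.

(** From the truncated exponent, each chosen direction is followed downwards as
    long as it remains the direction of its component. *)
Lemma cell_cover (m : 'X_{1..n}) :
  ~~ heavy e k m -> exists t, in_cell cell_base cell_directions t m.
Proof.
move=> nh; pose c := clamp m.
have cg v : c v < g.+1 by rewrite ltnS geq_minr.
pose low v : 'I_g.+1 :=
  if v \in directions c then [arg min_(t < Ordinal (cg v) | is_direction (update c v t) v) (t
      : nat)]
  else Ordinal (cg v).
pose s : box := [ffun v => low v].
have upd_id v : update c v (c v) = c.
  by apply/funext => u; rewrite /update; case: eqP => [->|].
have lowP v : v \in directions c ->
    [/\ is_direction (update c v (s v)) v, s v <= c v & forall t : 'I_g.+1,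
        is_direction (update c v t) v -> s v <= t].
  move=> vd; rewrite ffunE /low vd; case: arg_minnP => /= [|t dt mint].
    by rewrite upd_id; move: vd; rewrite inE => /andP[].
  split=> //; have := mint (Ordinal (cg v)); apply.
  by rewrite /= upd_id; move: vd; rewrite inE => /andP[].
have s_out v : v \notin directions c -> s v = c v :> nat.
  by move=> vd; rewrite ffunE /low (negPf vd).
have s_le v : box_val s v <= c v.
  by case: (boolP (v \in directions c)) => vd; [case: (lowP v vd)|rewrite /box_val s_out].
have s_comp v t : v \in directions c -> {in component v,
    update (box_val s) v t =1 update c v t}.
  move=> vd u uv; rewrite /update; case: eqP => // /eqP ne.
  by rewrite /box_val s_out //; apply: contra ne => ud;
      apply/eqP/(directions_uniq e_sym uv ud vd).
have sub : directions c \subset directions (box_val s).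
  apply/subsetP => v vd; have [ds _ _] := lowP v vd.
  have -> : v \in directions (box_val s) = is_direction (box_val s) v by move: vd;
      rewrite !inE => /andP[->].
  rewrite -(is_direction_ext (s_comp v (s v) vd)) in ds.
  rewrite (is_direction_ext (c' := update (box_val s) v (s v))) // => u _.
  by rewrite /update; case: eqP => [->|].
have dd := directions_sub_eq e_sym e_irr sub.
have cs : corner s.
  apply/andP; split.
    apply: contra nh => hs; apply: (heavy_le (c := c)) => [v|]; first exact: geq_minl.
    exact: heavy_le hs.
  apply/forall_inP => v; rewrite -dd => vd; apply/forallP => t; apply/implyP.
  rewrite ltnNge; apply: contra; rewrite (is_direction_ext (s_comp v t vd)) => dt.
  by have [_ _] := lowP v vd; apply.
exists (exist _ s cs : cell_index); apply/in_cellE; split=> //= v.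
by rewrite -dd => vd; rewrite /box_val s_out.
Qed.

Theorem sdepth_closure_ge (K : fieldType) :
  lee (Fin (num_bipartite_components e))
    (sdepth_quot (integral_closure (ideal_pow (edge_ideal e K) k))).
Proof.
apply: (sdepth_cells (@closure_heavy _ _ e_sym K k) cell_outside cell_cover cell_disj) => t.
by apply: leq_trans (card_directions e_sym e_irr (box_val (val t))) (subset_leq_card
    (subsetUl _ _)).
Qed.
End Cells.

(** * Ordered cochains and depth *)

Section Cochains.
Import GRing.Theory.
Local Open Scope ring_scope.
Variables (R : comNzRingType) (M : lmodType R) (I : Type).
Implicit Types (g h x : I -> R) (z y : seq I -> M) (s t : seq I) (N : M -> Prop).

(** The exterior product by the 1-cochain g, on cochains represented as functions
    on words of indices.  For g = x it is the differential of the ordered version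
    of the Koszul complex of x: unfolding the recursion gives the alternating sum
    of x_(s_i) z(s without s_i).  The recursion on the first letter makes signs
    implicit and is itself the homotopy formula: contraction with v followed or
    preceded by the differential adds up to multiplication by x_v. *)
Fixpoint wedge g z s : M :=
  if s is v :: s' then g v *: z s' - wedge g (fun t => z (v :: t)) s' else 0.

Lemma wedge_lin g a z y s :
  wedge g (fun t => a *: z t + y t) s = a *: wedge g z s + wedge g y s.
Proof.
elim: s z y => [|v s IH] z y /=; first by rewrite scaler0 addr0.
by rewrite IH scalerDr scalerBr !scalerA (mulrC (g v)) opprD addrACA.
Qed.

Lemma wedge_linl g h a z s :
  wedge (fun v => a * g v + h v) z s = a *: wedge g z s + wedge h z s.
Proof.
elim: s z => [|v s IH] z /=; first by rewrite scaler0 addr0.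
by rewrite IH scalerDl scalerBr scalerA opprD addrACA.
Qed.

Lemma wedge0 g s : wedge g (fun=> 0) s = 0.
Proof. by elim: s => [|v s IH] //=; rewrite scaler0 sub0r IH oppr0. Qed.

Lemma wedgeZ g a z s : wedge g (fun t => a *: z t) s = a *: wedge g z s.
Proof.
rewrite -[RHS]addr0 -(wedge0 g s) -wedge_lin; congr wedge.
by apply/funext => t; rewrite addr0.
Qed.

Lemma wedgeB g z y s : wedge g (fun t => z t - y t) s = wedge g z s - wedge g y s.
Proof.
rewrite addrC -scaleN1r -wedge_lin; congr wedge; apply/funext => t.
by rewrite scaleN1r addrC.
Qed.

Lemma wedge_wedge g z s : wedge g (wedge g z) s = 0.
Proof.
elim: s z => [|v s IH] z //=; rewrite wedgeB wedgeZ.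
by rewrite opprB addrC -addrA addNr addr0 IH.
Qed.

Lemma wedgeC g h z s : wedge g (wedge h z) s = - wedge h (wedge g z) s.
Proof.
elim: s z => [|v s IH] z /=; first by rewrite oppr0.
by rewrite !wedgeB !wedgeZ [wedge g (wedge h _) s]IH !opprB addrA.
Qed.

Definition submodule N : Prop := N 0 /\ forall a u v, N u -> N v -> N (a *: u + v).

Lemma submodD N u v : submodule N -> N u -> N v -> N (u + v).
Proof. by move=> [_ H] Nu Nv; rewrite -[u]scale1r; exact: H. Qed.

Lemma submodZ N a u : submodule N -> N u -> N (a *: u).
Proof. by move=> [N0 H] Nu; rewrite -[_ *: _]addr0; exact: H. Qed.

Lemma submodB N u v : submodule N -> N u -> N v -> N (u - v).
Proof. by move=> Ns Nu Nv; apply: submodD => //; rewrite -scaleN1r; exact: submodZ. Qed.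

Lemma submod_sum N (T : Type) (r : seq T) (F : T -> M) :
  submodule N -> (forall i, N (F i)) -> N (\sum_(i <- r) F i).
Proof.
by move=> Ns NF; elim/big_rec: _ => [|i u _ Nu]; [case: Ns|exact: submodD].
Qed.

Lemma wedge_submod N g z s : submodule N ->
  (forall v t, size s = (size t).+1 -> N (g v *: z t)) -> N (wedge g z s).
Proof.
move=> Ns; elim: s z => [|v s IH] z Nz /=; first by case: Ns.
apply: submodB => //; first exact: Nz.
by apply: IH => u t st; apply: Nz; rewrite /= st.
Qed.

Variable x : I -> R.
Local Notation d := (wedge x).

Definition cocycle N q z : Prop := forall s, size s = q.+1 -> N (d z s).
Definition coboundary N q z : Prop := exists y, forall s, size s = q -> N (z s - d y s).
(** In degree q, only words of length q matter for z, and words of length q + 1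
    for its differential; submodules N stand for the quotients of M by them. *)
Definition nonzero_class N q : Prop := exists z, cocycle N q z /\ ~ coboundary N q z.

Definition add_multiples N (f : R) (w : M) : Prop :=
  exists u v, N v /\ w = f *: u + v.

Section Step.
Import GRing.Theory.
Local Open Scope ring_scope.
Variables (N : M -> Prop) (f : R) (r : nat) (a : 'I_r -> R) (v : 'I_r -> I).
Hypotheses (Ns : submodule N) (fE : f = \sum_i a i * x (v i)).
Hypothesis freg : forall w, N (f *: w) -> N w.

(** A cocycle of degree 0 is an element killed by all the x_v, hence by f. *)
Lemma no_class0 : ~ nonzero_class N 0.
Proof.
case=> z [zc []]; exists (fun=> 0) => s /size0nil -> /=; rewrite subr0; apply: freg.
rewrite fE scaler_suml; apply: submod_sum => // i; rewrite -scalerA; apply: submodZ => //.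
by have := zc [:: v i] erefl; rewrite /= subr0.
Qed.

(** Multiplication by f is null-homotopic, so f z = d y with y a contraction of z.
    Modulo f, y is a cocycle of degree q.  If y = d w + f u, then f z = f d u, and
    regularity of f gives z = d u. *)
Lemma class_step q : nonzero_class N q.+1 -> nonzero_class (add_multiples N f) q.
Proof.
case=> z [zc zn]; pose y s := \sum_i a i *: z (v i :: s).
have hom s : size s = q.+1 -> N (f *: z s - d y s).
  move=> sq; have -> : d y s = \sum_i a i *: d (fun t => z (v i :: t)) s.
    rewrite /y; elim: (index_enum _) => [|i l IH].
      rewrite big_nil -[RHS](wedge0 x s); congr wedge.
      by apply/funext => t; rewrite big_nil.
    rewrite big_cons -IH -wedge_lin; congr wedge.
    by apply/funext => t; rewrite big_cons.
  rewrite fE scaler_suml -sumrB; apply: submod_sum => // i.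
  by rewrite -scalerA -scalerBr; apply: submodZ => //; apply: (zc (v i :: s)); rewrite /= sq.
exists y; split=> [s sq|[w wP]].
  exists (z s), (- (f *: z s - d y s)); split; last by rewrite opprB addrC subrK.
  by rewrite -scaleN1r; apply: submodZ => //; exact: hom.
have /choice[u uP] : forall s, exists u, size s = q -> N (y s - d w s - f *: u).
  move=> s; case: (eqVneq (size s) q) => [sq|/eqP sq]; last by exists 0.
  by have [u [t [Nt ->]]] := wP s sq; exists u => _; rewrite addrC addKr.
apply: zn; exists u => s sq; apply: freg; rewrite scalerBr.
have -> : f *: z s - f *: d u s =
    (f *: z s - d y s) + d (fun t => y t - d w t - f *: u t) s.
  by rewrite !wedgeB wedge_wedge wedgeZ subr0 addrA subrK.
apply: submodD => //; first exact: hom.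
by apply: wedge_submod => // v' t; rewrite sq => -[qt]; apply: submodZ => //; exact: uP.
Qed.
End Step.
End Cochains.

Section DepthBound.
Import GRing.Theory.
Local Open Scope ring_scope.
Variables (K : fieldType) (n : nat) (M : lmodType {mpoly K[n]}).
Local Notation S := {mpoly K[n]}.
Local Notation vars := (fun i : 'I_n => 'X_i : S).

Lemma seq_submodE (fs : seq S) (w : M) :
  seq_submod fs w <-> exists v : nat -> M, w = \sum_(i < size fs) fs`_i *: v i.
Proof.
split=> [[v ->]|[v ->]]; last by exists (fun i => v i).
exists (fun i => if insub i is Some j then v j else 0).
by apply: eq_bigr => i _; rewrite valK.
Qed.

Lemma seq_submod_rcons (fs : seq S) f (w : M) :
  seq_submod (rcons fs f) w <-> add_multiples (seq_submod fs) f w.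
Proof.
rewrite seq_submodE size_rcons; split=> [[v ->]|[u [v [/seq_submodE[t ->] ->]]]].
  exists (v (size fs)), (\sum_(i < size fs) fs`_i *: v i); split.
    by apply/seq_submodE; exists v.
  rewrite big_ord_recr /= nth_rcons ltnn eqxx addrC; congr (_ + _).
  by apply: eq_bigr => i _; rewrite nth_rcons ltn_ord.
exists (fun i => if i == size fs then u else t i).
rewrite big_ord_recr /= nth_rcons ltnn eqxx addrC; congr (_ + _).
by apply: eq_bigr => i _; rewrite nth_rcons ltn_ord ltn_eqF.
Qed.

Lemma seq_submod_submodule (fs : seq S) : submodule (@seq_submod K n M fs).
Proof.
split=> [|a _ _ [u ->] [v ->]].
  by exists (fun=> 0); rewrite big1 // => i _; rewrite scaler0.
exists (fun i => a *: u i + v i); rewrite scaler_sumr -big_split; apply: eq_bigr => i _.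
by rewrite scalerDr !scalerA mulrC.
Qed.

(** Each element of a regular sequence lowers by one the degree of a nonzero
    class, by [class_step], and by [no_class0] none can follow once the degree is
    0. *)
Theorem depth_le p : nonzero_class vars (fun w : M => w = 0) p -> lee (depth M) (Fin p).
Proof.
move=> cls; apply/supe_lub => _ [fs [fm [freg _] ->]] /=; rewrite leqNgt; apply/negP => ltp.
have step i : (i < size fs)%N -> exists r (a : 'I_r -> S) (v : 'I_r -> 'I_n),
    fs`_i = \sum_j a j * 'X_(v j).
  move=> /fm [r [a [g [/choice[v vP] ->]]]]; exists r, a, v.
  by apply: eq_bigr => j _; rewrite vP.
have H i : (i <= p)%N -> nonzero_class vars (@seq_submod K n M (take i fs)) (p - i).
  elim: i => [|i IH] ip.
    rewrite take0 subn0; suff -> : @seq_submod K n M [::] = (fun w => w = 0) by [].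
    apply/funext => w; apply/propext; split=> [[v ->]|->]; first by rewrite big_ord0.
    by exists (fun=> 0); rewrite big_ord0.
  have isz : (i < size fs)%N by apply: ltn_trans ltp.
  have [r [a [v fE]]] := step i isz.
  have := IH (ltnW ip); rewrite (_ : (p - i = (p - i.+1).+1)%N); last by lia.
  move/(@class_step _ _ _ vars _ _ _ _ _ (seq_submod_submodule _) fE (freg i isz)).
  suff -> : @seq_submod K n M (take i.+1 fs) =
      add_multiples (@seq_submod K n M (take i fs)) fs`_i by [].
  apply/funext => w; apply/propext; rewrite (take_nth 0 isz); exact: seq_submod_rcons.
have [r [a [v fE]]] := step p ltp.
have := H p (leqnn p); rewrite subnn.
exact: (@no_class0 _ _ _ vars _ _ _ _ _ (seq_submod_submodule _) fE (freg p ltp)).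
Qed.
End DepthBound.

(** * A cocycle and a functional that detects it *)

Section Wedges.
Import GRing.Theory.
Local Open Scope ring_scope.
Variables (R : comNzRingType) (M : lmodType R) (I : eqType) (T : eqType).
Variable (G : T -> I -> R).
Implicit Types (g h : I -> R) (z y : seq I -> M) (s t : seq I) (N : M -> Prop) (js : seq T).

Definition wedges js z : seq I -> M := foldr (fun j => wedge (G j)) z js.

Lemma wedge_wedges g js z s :
  (forall t, wedge g z t = 0) -> wedge g (wedges js z) s = 0.
Proof.
move=> gz; elim: js s => [|j js IH] s //=; rewrite wedgeC.
by rewrite (funext IH) wedge0 oppr0.
Qed.

Lemma wedge_wedges_mem js z j s : j \in js -> wedge (G j) (wedges js z) s = 0.
Proof.
elim: js s => [|i js IH] s //=; rewrite inE; case: eqP => [->|_ /= jin].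
  by rewrite wedge_wedge.
rewrite wedgeC (_ : wedge (G j) _ = fun=> 0) ?wedge0 ?oppr0 //.
by apply/funext => t; exact: IH.
Qed.

Lemma wedges_submod N js z s : submodule N -> (forall t, N (z t)) -> N (wedges js z s).
Proof.
move=> Ns Nz; elim: js s => [|j js IH] s //=.
by apply: wedge_submod => // v t _; apply: submodZ.
Qed.

(** In an iterated product, the factor coming from G j may be moved to the front
    of each term. *)
Lemma wedges_submod_mem N js z j s : submodule N -> j \in js ->
  (forall u t, N (G j u *: z t)) -> N (wedges js z s).
Proof.
move=> Ns + Nz; elim: js s => [|i js IH] s //=; rewrite inE; case: eqP => [<- _|_ /= jin].
  apply: wedge_submod => // v t _.
  apply: (wedges_submod (N := fun m => N (G j v *: m))) => //; split.
    by rewrite scaler0; case: Ns.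
  by move=> a m m' Nm Nm'; rewrite scalerDr scalerA mulrC -scalerA; case: Ns => _; apply.
by apply: wedge_submod => // v t _; apply: submodZ => //; exact: IH.
Qed.

Lemma wedge_suml js (a : T -> R) h z s :
  wedge (fun v => \sum_(j <- js) a j * G j v + h v) z s =
  \sum_(j <- js) a j *: wedge (G j) z s + wedge h z s.
Proof.
elim: js => [|j js IH].
  rewrite big_nil add0r; congr wedge; apply/funext => v; by rewrite big_nil add0r.
rewrite big_cons -addrA -IH -wedge_linl; congr wedge; apply/funext => v.
by rewrite big_cons addrA.
Qed.

Lemma wedge_vanish g z s : (forall v, v \in s -> g v = 0) -> wedge g z s = 0.
Proof.
elim: s z => [|v s IH] z gs //=; rewrite gs ?mem_head // scale0r sub0r IH ?oppr0 //.
by move=> u us; apply: gs; rewrite inE us orbT.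
Qed.
End Wedges.

Section Pairing.
Import GRing.Theory.
Local Open Scope ring_scope.
Variables (K : fieldType) (n : nat) (J : ideal {mpoly K[n]}) (in_expo : 'X_{1..n} -> bool).
Local Notation S := {mpoly K[n]}.
Local Notation M := (quot_mod J).
Hypothesis JE : forall f, J f <-> forall m, m \in msupp f -> in_expo m.
Hypothesis bad_mono : forall m m' : 'X_{1..n}, in_expo m -> in_expo (m + m')%MM.
Local Notation vars := (fun i : 'I_n => 'X_i : S).
Implicit Types (c : 'X_{1..n}) (y z : seq 'I_n -> M) (m : M) (ps : seq ('I_n * 'I_n)).

(** The representative is arbitrary; the coefficient depends only on the class
    when no element of J involves the exponent c. *)
Definition coef_at c m : K := (quot_repr m)@_c.

Lemma coef_at_pi c f : ~~ in_expo c -> coef_at c (quot_pi J f) = f@_c.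
Proof.
move=> nb; apply/eqP; rewrite -subr_eq0 -mcoeffB mcoeff_eq0; apply: contra nb.
have /JE Jf : J (quot_repr (quot_pi J f) - f) by apply/quot_piP; rewrite quot_reprK.
exact: Jf.
Qed.

Lemma coef_atB c m m' : ~~ in_expo c -> coef_at c (m - m') = coef_at c m - coef_at c m'.
Proof.
move=> nb; rewrite -[m]quot_reprK -[m']quot_reprK !coef_at_pi //.
have -> : quot_pi J (quot_repr m) - quot_pi J (quot_repr m') =
    quot_pi J (quot_repr m - quot_repr m').
  apply/eqP; rewrite subr_eq -quot_piD; apply/eqP; congr quot_pi.
  by rewrite subrK.
by rewrite coef_at_pi // mcoeffB.
Qed.

Lemma coef_at0 c : ~~ in_expo c -> coef_at c 0 = 0.
Proof. by move=> nb; rewrite -(subrr 0) coef_atB // subrr. Qed.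

Lemma good_sub c c' : ~~ in_expo (c + c')%MM -> ~~ in_expo c.
Proof. by apply: contra; exact: bad_mono. Qed.

Lemma coef_at_shift c v m : ~~ in_expo (c + U_(v))%MM ->
  coef_at (c + U_(v))%MM ('X_v *: m) = coef_at c m.
Proof.
move=> nb; rewrite -[m]quot_reprK quot_piZ !coef_at_pi ?(good_sub nb) //.
by rewrite mulrC addmC mcoeffMX.
Qed.

Lemma coef_at_var c v m : ~~ in_expo c -> c v = 0%N -> coef_at c ('X_v *: m) = 0.
Proof.
move=> nb cv; rewrite -[m]quot_reprK quot_piZ coef_at_pi //.
apply: memN_msupp_eq0; apply/negP => /msuppM_le /allpairsP[[m1 m2] /= [/mem_msuppXP <- _ E]].
by move: cv; rewrite E mnmDE mnm1E eqxx.
Qed.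

Variable ws : seq 'I_n.

Definition selects ps (ts : seq 'I_n) : bool :=
  all2 (fun p v => (v == p.1) || (v == p.2)) ps ts.

(** Every exponent met by the pairing below lies outside J, where coefficients are
    well defined on S / J. *)
Definition admissible ps c : Prop := forall ts, selects ps ts ->
  let c' := (c + \big[mnm_add/0%MM]_(v <- ts) U_(v))%MM in
  ~~ in_expo c' /\ forall w, w \in ws -> c' w = 0%N.

(** Evaluation on a product of 0-spheres: each pair p contributes the cycle p.1 -
    p.2, and the value on a word is its coefficient at c plus the exponents of
    the chosen letters.  The letters of ws only contribute to the word. *)
Fixpoint pairing ps c y : K :=
  if ps is p :: ps' then
    pairing ps' (c + U_(p.1))%MM (fun s => y (p.1 :: s))
    - pairing ps' (c + U_(p.2))%MM (fun s => y (p.2 :: s))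
  else coef_at c (y ws).

Lemma admissible_nil c : admissible [::] c -> ~~ in_expo c /\ forall w, w \in ws -> c w = 0%N.
Proof. by move=> /(_ [::] isT); rewrite big_nil addm0. Qed.

Lemma admissible_cons p ps c v : (v == p.1) || (v == p.2) -> admissible (p :: ps) c ->
    admissible ps (c + U_(v))%MM.
Proof.
move=> vp g ts tps; have := g (v :: ts); rewrite /selects /= vp => /(_ tps).
by rewrite big_cons addmA.
Qed.

Lemma admissible_shift ps c v : admissible ps (c + U_(v))%MM -> admissible ps c.
Proof.
move=> g ts /g /=; rewrite -addmA [(U_(v) + _)%MM]addmC addmA => -[nb c0]; split.
  exact: good_sub nb.
by move=> w /c0; rewrite mnmDE => /eqP; rewrite addn_eq0 => /andP[/eqP].
Qed.

Lemma pairing_ext ps c y z :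
  (forall ts, selects ps ts -> y (ts ++ ws) = z (ts ++ ws)) -> pairing ps c y = pairing ps c z.
Proof.
elim: ps c y z => [|p ps IH] c y z yz /=; first by rewrite (yz [::]).
congr (_ - _); apply: IH => ts tps; apply: (yz (_ :: ts));
    rewrite /selects /= -/(selects ps ts) tps eqxx ?orbT //.
Qed.

Lemma pairingB ps c y z : admissible ps c ->
  pairing ps c (fun s => y s - z s) = pairing ps c y - pairing ps c z.
Proof.
elim: ps c y z => [|p ps IH] c y z g /=; first by rewrite coef_atB //; case: (admissible_nil g).
rewrite !IH; [|apply: admissible_cons g; by rewrite eqxx ?orbT..].
by rewrite opprB opprD opprK -!addrA; congr (_ + _); rewrite addrA addrC addrA.
Qed.

Lemma pairing0 ps c : admissible ps c -> pairing ps c (fun=> 0) = 0.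
Proof.
move=> g; rewrite -[LHS](_ : pairing ps c (fun s => 0 - 0) = _);
    first by rewrite pairingB // subrr.
by apply: pairing_ext => ts _; rewrite subrr.
Qed.

Lemma pairing_shift ps c v y : admissible ps (c + U_(v))%MM ->
  pairing ps (c + U_(v))%MM (fun s => 'X_v *: y s) = pairing ps c y.
Proof.
elim: ps c y => [|p ps IH] c y g /=.
  by rewrite coef_at_shift //; case: (admissible_nil g).
have sh u : (c + U_(v) + U_(u) =
    c + U_(u) + U_(v))%MM by rewrite -addmA [(U_(v) + _)%MM]addmC addmA.
by rewrite !sh !IH // -sh; apply: admissible_cons g; rewrite eqxx ?orbT.
Qed.

(** Each term of the differential is a multiple of some x_w with w in s, and such
    multiples have no monomial whose exponent vanishes at w. *)
Lemma coef_at_wedge c y s : ~~ in_expo c -> (forall w, w \in s -> c w = 0%N) ->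
  coef_at c (wedge vars y s) = 0.
Proof.
move=> nb; elim: s y => [|v s IH] y cs /=; first exact: coef_at0.
rewrite coef_atB // coef_at_var ?cs ?mem_head // IH ?subrr // => w ws'.
by apply: cs; rewrite inE ws' orbT.
Qed.

(** The pairing vanishes on coboundaries: the terms in which the first letter is
    removed do not depend on the choice between p.1 and p.2, so they cancel. *)
Lemma pairing_wedge ps c y : admissible ps c -> pairing ps c (wedge vars y) = 0.
Proof.
elim: ps c y => [|p ps IH] c y g /=.
  by have [nb c0] := admissible_nil g; exact: coef_at_wedge.
have g1 : admissible ps (c + U_(p.1))%MM by apply: admissible_cons g; rewrite eqxx.
have g2 : admissible ps (c + U_(p.2))%MM by apply: admissible_cons g; rewrite eqxx orbT.
by rewrite !pairingB // !pairing_shift // !IH // !subr0 subrr.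
Qed.

Variables (T : eqType) (js : seq T) (A : T -> {set 'I_n}) (al be : T -> 'I_n).
Variable a : 'X_{1..n}.

Definition side_form (C : T) v : S := if v \in A C then 'X_v else 0.
Definition point_form (w v : 'I_n) : S := (v == w)%:R.
Definition monomial_cochain (s : seq 'I_n) : M := if s is [::] then quot_pi J 'X_[a] else 0.
Definition side_cochain : seq 'I_n -> M :=
  wedges side_form js (wedges point_form ws monomial_cochain).
Local Notation pairs := [seq (al C, be C) | C <- js].

Hypothesis al_in : forall C, C \in js -> al C \in A C.
Hypothesis be_out : forall C, C \in js -> be C \notin A C.
Hypothesis pair_out : forall C C', C \in js -> C' \in js -> C != C' ->
  (al C \notin A C') && (be C \notin A C').
Hypothesis ws_out : forall C w, C \in js -> w \in ws -> w \notin A C.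
Hypotheses (ujs : uniq js) (uws : uniq ws).

Lemma point_wedges_self : wedges point_form ws monomial_cochain ws = quot_pi J 'X_[a].
Proof.
elim: ws uws => [|w l IH] //= /andP[wl ul].
rewrite /point_form eqxx scale1r -/point_form wedge_vanish ?subr0 ?IH // => v vl.
by rewrite (negPf (memPn wl _ vl)).
Qed.

(** Along the words selected by the pairing, only the diagonal term of the
    exterior product survives, and only for the word whose letters are all of the
    form [al C]. *)
Lemma pairing_cochain : admissible pairs a -> pairing pairs a side_cochain = 1.
Proof.
rewrite /side_cochain; move: al_in be_out pair_out ws_out ujs.
elim: js => [|C l IH] aI bO pO wO /=.
  move=> _ g; have [nb _] := admissible_nil g.
  by rewrite point_wedges_self coef_at_pi // mcoeffX eqxx.
case/andP=> Cl ul g; set Z := wedges _ _ _ in IH *.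
have out ts v : selects [seq (al C, be C) | C <- l] ts -> v \in ts ++ ws -> side_form C v = 0.
  move=> sel; rewrite mem_cat /side_form => vin; case: ifP => // vC; exfalso.
  case/orP: vin => [|/(wO C v (mem_head _ _))]; last by rewrite vC.
  have : forall C', C' \in l -> (al C' \notin A C) && (be C' \notin A C).
    move=> C' C'l; apply: pO; rewrite ?inE ?C'l ?eqxx ?orbT //.
    by apply: contraNneq Cl => <-.
  elim: l {IH aI bO pO wO Cl ul g Z} ts sel => [|C' l IHl] [|t ts] //=.
  case/andP=> tC sel H; rewrite inE => /orP[/eqP vt|vts].
    have /andP[h1 h2] := H C' (mem_head _ _).
    by case/orP: tC => /eqP tE; move: h1 h2; rewrite -tE -vt vC.
  by apply: (IHl ts) => // D Dl; apply: H; rewrite inE Dl orbT.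
have g1 : admissible [seq (al C,
    be C) | C <- l] (a + U_(al C))%MM by apply: admissible_cons g; rewrite eqxx.
have g2 : admissible [seq (al C,
    be C) | C <- l] (a + U_(be C))%MM by apply: admissible_cons g; rewrite eqxx orbT.
rewrite (@pairing_ext _ _ _ (fun s => 'X_(al C) *: Z s)); last first.
  move=> ts sel; rewrite wedge_vanish ?subr0 => [|v]; last exact: (out ts).
  by rewrite /side_form aI ?mem_head.
rewrite [X in _ - X](@pairing_ext _ _ _ (fun s => 0)); last first.
  move=> ts sel; rewrite wedge_vanish ?subr0 => [|v]; last exact: (out ts).
  by rewrite /side_form (negPf (bO _ _)) ?mem_head // scale0r.
rewrite pairing0 // subr0 pairing_shift // IH //.
- by move=> D Dl; apply: aI; rewrite inE Dl orbT.
- by move=> D Dl; apply: bO; rewrite inE Dl orbT.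
- by move=> D D' Dl Dl'; apply: pO; rewrite inE ?Dl ?Dl' orbT.
- by move=> D w Dl; apply: wO; rewrite inE Dl orbT.
- exact: admissible_shift g1.
Qed.

Hypothesis A_disj : forall C C' v, C \in js -> C' \in js -> v \in A C -> v \in A C' -> C = C'.
Hypothesis vertex_kinds : forall v,
  [\/ exists2 C, C \in js & v \in A C, v \in ws,
      exists2 C, C \in js & forall u, u \in A C -> J ('X_v * 'X_u * 'X_[a]) |
      J ('X_v * 'X_[a])].

Lemma monomial_cochain_killed (f : S) s :
  J (f * 'X_[a]) -> f *: monomial_cochain s = 0.
Proof.
by move=> Jf; case: s => [|v s] /=; [rewrite quot_piZ; apply/quot_pi_eq0|rewrite scaler0].
Qed.

Lemma killed_submodule (f : S) : submodule (fun m => f *: m = 0).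
Proof.
split=> [|b u u' fu fu']; first by rewrite scaler0.
by rewrite scalerDr scalerA mulrC -scalerA fu fu' scaler0 addr0.
Qed.

(** The 1-cochain x is a combination of the factors of the product, each of which
    kills it, and of a remainder supported on the vertices v outside all A C and
    ws; there x_v kills each value of the product by [vertex_kinds]. *)
Lemma side_cochain_cocycle s : wedge vars side_cochain s = 0.
Proof.
pose h v : S := 'X_v - \sum_(C <- js) 1 * side_form C v - \sum_(w <- ws) 'X_w * point_form w v.
have -> : vars = fun v => \sum_(C <- js) 1 * side_form C v + (\sum_(w <- ws) 'X_w *
    point_form w v + h v).
  by apply/funext => v; rewrite /h [X in _ + X]addrC subrK addrC subrK.
rewrite !wedge_suml.
rewrite big1_seq ?add0r => [|C /andP[_ Cj]]; last by rewrite wedge_wedges_mem // scaler0.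
rewrite big1_seq ?add0r => [|w /andP[_ wj]]; last first.
  rewrite wedge_wedges ?scaler0 // => t; exact: wedge_wedges_mem.
apply: (wedge_submod (N := fun m => m = 0)) => [|v t _].
  by split=> // b u u' -> ->; rewrite scaler0 addr0.
have side0 C : v \notin A C -> side_form C v = 0 by rewrite /side_form => /negPf ->.
have Xkill : 'X_v *: side_cochain t = 0 -> (forall C, C \in js -> v \notin A C) ->
    v \notin ws ->
    h v *: side_cochain t = 0.
  move=> k1 k2 k3; rewrite /h !big1_seq ?subr0 // => [w|C] /andP[_ win].
    by rewrite /point_form; case: eqP win k3 => [<- ->|]; rewrite ?mulr0.
  by rewrite side0 ?mulr0 // k2.
case: (boolP (has (fun C => v \in A C) js)) => [/hasP[C Cj vC]|/hasPn nA].
  rewrite /h (bigD1_seq C) //= [side_form C v]/side_form vC mul1r.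
  rewrite big1_seq => [|C' /andP[C'C C'j]]; last first.
    by rewrite side0 ?mulr0 //; apply: contra C'C => vC'; rewrite (A_disj C'j Cj vC' vC).
  rewrite addr0 subrr sub0r big1_seq ?oppr0 ?scale0r // => w /andP[_ wj].
  rewrite /point_form; case: eqP => [vw|_]; rewrite ?mulr0 //.
  by have := ws_out Cj wj; rewrite -vw vC.
case: (boolP (v \in ws)) => vws.
  rewrite /h big1_seq ?subr0 => [|C /andP[_ Cj]]; last by rewrite side0 ?mulr0 ?nA.
  rewrite (bigD1_seq v) //= /point_form eqxx mulr1 big1_seq ?addr0 ?subrr ?scale0r //.
  by move=> w /andP[wv _]; rewrite eq_sym (negPf wv) mulr0.
apply: Xkill => //; rewrite /side_cochain;
    case: (vertex_kinds v) => [[C Cj vC]|vw|[C Cj Hu]|Jv].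
- by have := nA C Cj; rewrite vC.
- by rewrite vw in vws.
- apply: (@wedges_submod_mem _ _ _ _ side_form _ _ _ _ t (killed_submodule 'X_v) Cj) => u t'.
  rewrite /side_form; case: ifP => uC; last by rewrite scale0r scaler0.
  apply: (wedges_submod _ _ (N := fun m => 'X_v *: ('X_u *: m) = 0)) => [|t''].
    have [k1 k2] := killed_submodule ('X_v * 'X_u).
    by split=> [|b m m']; rewrite !scalerA //; exact: k2.
  by rewrite scalerA; apply: monomial_cochain_killed; exact: Hu.
- apply: (@wedges_submod _ _ _ _ side_form _ _ _ _ (killed_submodule 'X_v)) => t'.
  apply: (@wedges_submod _ _ _ _ point_form _ _ _ _ (killed_submodule 'X_v)) => t''.
  exact: monomial_cochain_killed.
Qed.

Lemma side_class_nonzero : admissible pairs a ->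
  nonzero_class vars (fun m => m = 0) (size js + size ws).
Proof.
move=> g; exists side_cochain; split=> [s _|[y yP]]; first exact: side_cochain_cocycle.
have := pairing_cochain g; rewrite (@pairing_ext _ _ _ (wedge vars y)).
  by rewrite pairing_wedge // => /esym/eqP; rewrite oner_eq0.
move=> ts; rewrite /selects all2E size_map => /andP[/eqP sz _].
by apply/eqP; rewrite -subr_eq0; apply/eqP/yP; rewrite size_cat sz.
Qed.
End Pairing.

(** * Exact covers *)

Section DeepExponent.
Variables (n : nat) (e : rel 'I_n).
Hypotheses (e_sym : symmetric e) (e_irr : irreflexive e).
Implicit Types (P : {set 'I_n} * {set 'I_n}) (c : 'I_n -> nat) (u v w : 'I_n).
Local Notation component := (component e).
Local Notation total := (cweight [set: 'I_n]).

Lemma total_add c c' P : total (fun v => c v + c' v) P = total c P + total c' P.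
Proof. by rewrite /cweight -big_split; apply: eq_bigr => v _; rewrite mulnDl. Qed.

Lemma total_scale m c P : total (fun v => m * c v) P = m * total c P.
Proof. by rewrite /cweight big_distrr; apply: eq_bigr => v _; rewrite /= mulnA. Qed.

Lemma total_point u P : total (fun v => v == u : nat) P = cmult P u.
Proof.
rewrite /cweight (bigD1 u) ?inE //= eqxx mul1n big1 ?addn0 // => v /andP[_ /negPf->].
by rewrite mul0n.
Qed.

Lemma total_mnmD (m m' : 'X_{1..n}) P : total (m + m')%MM P = total m P + total m' P.
Proof. by rewrite -total_add; apply: cweight_ext => v _; rewrite mnmDE. Qed.

Lemma total_mnm1 u P : total U_(u)%MM P = cmult P u.
Proof. by rewrite -total_point; apply: cweight_ext => v _; rewrite mnm1E eq_sym. Qed.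

(** The covers meeting every edge of the double cover exactly once. *)
Definition exact_dcover P : Prop := forall u v, e u v -> (u \in P.1) = (v \notin P.2).

Definition degree v : nat := \sum_w e v w.
Definition edges : nat := \sum_v degree v.

Lemma total_degree P : total degree P = \sum_u \sum_w e u w * ((u \in P.1) + (w \in P.2)).
Proof.
transitivity (\sum_u \sum_w e u w * (u \in P.1) + \sum_u \sum_w e u w * (u \in P.2)).
  rewrite /cweight -big_split; apply: eq_big => [u|u _] /=; first by rewrite inE.
  by rewrite /cmult mulnDr /degree !big_distrl.
rewrite [X in _ + X]exchange_big -big_split; apply: eq_bigr => u _ /=.
by rewrite -big_split; apply: eq_bigr => w _; rewrite /= [e w u]e_sym mulnDr.
Qed.

Lemma total_degree_exact P : exact_dcover P -> total degree P = edges.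
Proof.
move=> ex; rewrite total_degree; apply: eq_bigr => u _; apply: eq_bigr => w _.
by case: (boolP (e u w)) => // /ex ->; case: (w \in P.2).
Qed.

Lemma total_degree_inexact P : dcover e P -> ~ exact_dcover P -> edges < total degree P.
Proof.
move=> /bicoverP cP nex.
have [u [w [uw u1 w2]]] : exists u w, [/\ e u w, u \in P.1 & w \in P.2].
  apply: contrapT => none; apply: nex => u w uw.
  have := cP u w uw; case: (boolP (u \in P.1)) => [u1 _|_ /= -> //].
  by apply/esym/negP => w2; apply: none; exists u, w.
have le (u' w' : 'I_n) : (e u' w' : nat) <= e u' w' * ((u' \in P.1) + (w' \in P.2)).
  by case: (boolP (e u' w')) => // /cP; case: (u' \in P.1); case: (w' \in P.2).
rewrite total_degree /edges (bigD1 u) //= [X in _ < X](bigD1 u) //= -addSn leq_add //;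
    last first.
  by apply: leq_sum => u' _; apply: leq_sum.
rewrite /degree (bigD1 w) //= [X in _ < X](bigD1 w) //= -addSn leq_add //; last exact: leq_sum.
by rewrite uw u1 w2.
Qed.

Lemma component_const (f : 'I_n -> bool) r :
  (forall u v, u \in component r -> e u v -> f u = f v) ->
  forall v, v \in component r -> f v = f r.
Proof.
move=> fe v; rewrite mem_component => /connectP[p pp ->].
suff H x : x \in component r -> f x = f r -> path e x p -> f (last x p) = f r.
  exact: H (component_refl e r) (erefl _) pp.
elim: p x {pp} => [|y p IH] x xr //= fx /andP[xy yp]; apply: IH => //.
  exact: component_step xy.
by rewrite -(fe x).
Qed.

(** Along the edges of the component, u in L for u in A and v not in R for v
    outside A propagate into each other, and likewise with L and R exchanged. *)
Lemma exact_bipartite P r (A : {set 'I_n}) : exact_dcover P ->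
  (forall u v, u \in component r -> e u v -> (u \in A) != (v \in A)) ->
  forall u v, u \in component r -> v \in component r -> u \in A -> v \notin A ->
  cmult P u + cmult P v = 2.
Proof.
move=> ex HA u v ur vr uA vA.
have one : (u \in P.1) = (v \notin P.2).
  have H : forall v, v \in component r -> (if v \in A then v \in P.1 else v \notin P.2) =
      (if r \in A then r \in P.1 else r \notin P.2).
    apply: (component_const (f :=
        fun z => if z \in A then z \in P.1 else z \notin P.2)) => x y xr xy; have :=
        HA _ _ xr xy.
    have := ex _ _ xy; have := ex y x; rewrite e_sym xy => /(_ isT).
    case: (x \in A); case: (y \in A) => //;
      by case: (x \in P.1); case: (x \in P.2); case: (y \in P.1); case: (y \in P.2).
  by have := H u ur; have := H v vr; rewrite uA (negPf vA) => -> ->.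
have two : (u \in P.2) = (v \notin P.1).
  have H : forall v, v \in component r -> (if v \in A then v \in P.2 else v \notin P.1) =
      (if r \in A then r \in P.2 else r \notin P.1).
    apply: (component_const (f :=
        fun z => if z \in A then z \in P.2 else z \notin P.1)) => x y xr xy; have :=
        HA _ _ xr xy.
    have := ex _ _ xy; have := ex y x; rewrite e_sym xy => /(_ isT).
    case: (x \in A); case: (y \in A) => //;
      by case: (x \in P.1); case: (x \in P.2); case: (y \in P.1); case: (y \in P.2).
  by have := H u ur; have := H v vr; rewrite uA (negPf vA) => -> ->.
by rewrite /cmult one two; case: (v \in P.1); case: (v \in P.2).
Qed.

(** If v lies in neither part of an exact cover, its neighbours lie in both, their
    neighbours in neither, and so on: this is a 2-colouring of the component. *)
Lemma exact_nonbipartite P v : exact_dcover P -> ~~ bipartite e (component v) -> 0 < cmult P v.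
Proof.
move=> ex; apply: contraR; rewrite -eqn0Ngt addn_eq0 !eqb0 => /andP[v1 v2].
have H : forall z, z \in component v -> ((z \in P.1) == (z \in P.2)) =
    ((v \in P.1) == (v \in P.2)).
  apply: (component_const (f := fun z => (z \in P.1) == (z \in P.2))) => x y _ xy.
  have := ex _ _ xy; have := ex y x; rewrite e_sym xy => /(_ isT).
  by case: (y \in P.1); case: (x \in P.1); case: (x \in P.2); case: (y \in P.2).
apply/existsP; exists P.1; apply/forall_inP => x xv; apply/forall_inP => y yv.
apply/implyP => xy; have := H y yv; rewrite (negPf v1) (negPf v2) eqxx => /eqP ->.
by rewrite (ex _ _ xy); case: (y \in P.2).
Qed.
End DeepExponent.

(** * An exponent deep in the edge cone *)

Section DeepMonomial.
Variables (n : nat) (e : rel 'I_n).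
Hypotheses (e_sym : symmetric e) (e_irr : irreflexive e).
Implicit Types (P : {set 'I_n} * {set 'I_n}) (c : 'I_n -> nat) (u v w : 'I_n).
Local Notation component := (component e).
Local Notation total := (cweight [set: 'I_n]).

Definition edge_vec v : nat :=
  if [pick p : 'I_n * 'I_n | e p.1 p.2] is Some p then (v == p.1) + (v == p.2) else 0.

Definition odd_vec v : nat :=
  if [pick t | ~~ bipartite e (component t)] is Some t then v == t else 0.

Lemma total0 P : total (fun=> 0) P = 0.
Proof. by rewrite /cweight big1 // => v _; rewrite mul0n. Qed.

Lemma total_edge_vec_ge P u w : dcover e P -> e u w -> 2 <= total edge_vec P.
Proof.
move=> cP uw; rewrite /edge_vec; case: pickP => [p ep|/(_ (u, w))]; last by rewrite /= uw.
rewrite total_add !total_point /cmult; have /bicoverP H := cP.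
have := H _ _ ep; have := H p.2 p.1; rewrite e_sym ep => /(_ isT).
by case: (p.1 \in P.1); case: (p.1 \in P.2); case: (p.2 \in P.1); case: (p.2 \in P.2).
Qed.

Lemma total_edge_vec_le P : exact_dcover e P -> total edge_vec P <= 2.
Proof.
move=> ex; rewrite /edge_vec; case: pickP => [p ep|_]; last by rewrite total0.
rewrite total_add !total_point /cmult.
have := ex _ _ ep; have := ex p.2 p.1; rewrite e_sym ep => /(_ isT).
by case: (p.1 \in P.1); case: (p.1 \in P.2); case: (p.2 \in P.1); case: (p.2 \in P.2).
Qed.

Lemma total_odd_vec P v : exact_dcover e P -> ~~ bipartite e (component v) ->
    0 < total odd_vec P.
Proof.
move=> ex nb; rewrite /odd_vec; case: pickP => [t nt|/(_ v)]; last by rewrite nb.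
by rewrite total_point; apply: exact_nonbipartite nt.
Qed.

Lemma total_mnm_sum (ts : seq 'I_n) P :
  total (\big[mnm_add/0%MM]_(v <- ts) U_(v))%MM P = \sum_(v <- ts) cmult P v.
Proof.
elim: ts => [|v ts IH]; rewrite ?big_nil ?big_cons.
  by rewrite -[RHS](total0 P); apply: cweight_ext => v _; rewrite mnm0E.
by rewrite total_mnmD total_mnm1 IH.
Qed.

Variable k : nat.
Hypothesis k_big : edges e < k.

(** Twice the degree vector has weight 2E on exact covers, with E the number of
    ordered edges, and at least 2E + 2 on all others.  If there is
    an edge, a multiple of it brings the weight on exact covers up to 2k - 2, and
    one vertex of a nonbipartite component, if there is one, raises it to at
    least 2k - 1. *)
Definition deep_exponent : 'X_{1..n} :=
  [multinom 2 * degree e v + (k - (edges e).+1) * edge_vec v + odd_vec v | v < n].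

Lemma total_deep P :
  total deep_exponent P =
      2 * total (degree e) P + (k - (edges e).+1) * total edge_vec P + total odd_vec P.
Proof.
rewrite -!total_scale -!total_add; apply: cweight_ext => v _; exact: mnmE.
Qed.

Lemma deep_heavy (c : 'X_{1..n}) :
  (exists u w, e u w) ->
  (forall P, dcover e P -> exact_dcover e P -> 2 <= total odd_vec P + total c P) ->
  heavy e k (deep_exponent + c)%MM.
Proof.
move=> [u [w uw]] Hc; apply/heavyP => P cP; rewrite total_mnmD total_deep.
have ge2 := total_edge_vec_ge cP uw.
case: (pselect (exact_dcover e P)) => ex.
  have := Hc P cP ex; rewrite (total_degree_exact e_sym ex); nia.
have := total_degree_inexact e_sym cP ex; nia.
Qed.

Lemma deep_light (c : 'X_{1..n}) P :
  dcover e P -> exact_dcover e P -> total odd_vec P <= 1 -> total c P = 0 ->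
      ~~ heavy e k (deep_exponent + c)%MM.
Proof.
move=> cP ex odd c0; apply/negP => /heavyP/(_ P cP).
rewrite total_mnmD total_deep c0 (total_degree_exact e_sym ex).
have := total_edge_vec_le ex; nia.
Qed.

Definition isolated v : bool := [forall u, ~~ e v u].

Lemma deep_isolated v : isolated v -> bipartite e (component v) -> deep_exponent v = 0.
Proof.
move=> /forallP iv bv; rewrite mnmE.
have -> : degree e v = 0 by rewrite /degree big1 // => w _; rewrite (negPf (iv w)).
have -> : edge_vec v = 0.
  rewrite /edge_vec; case: pickP => // -[p1 p2] /= ep.
  case: eqP => [vp|_]; first by have := iv p2; rewrite vp ep.
  by case: eqP => [vp|//]; have := iv p1; rewrite vp e_sym ep.
have -> : odd_vec v = 0.
  by rewrite /odd_vec; case: pickP => // t; case: eqP => // <-; rewrite bv.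
by rewrite !muln0.
Qed.

(** One vertex of each bipartite component. *)
Definition reps : {set 'I_n} := [set v | (fingraph.root e v == v) && bipartite e (component v)].

Lemma component_root v : component (fingraph.root e v) = component v.
Proof. by apply: component_eq => //; rewrite mem_component connect_root. Qed.

Lemma root_component u v : u \in component v -> fingraph.root e u = fingraph.root e v.
Proof.
rewrite mem_component => vu; apply/esym/eqP; rewrite root_connect //; exact: connectC.
Qed.

Lemma card_reps : #|reps| = num_bipartite_components e.
Proof.
rewrite /num_bipartite_components -(card_in_imset (f := component) (D := reps)).
  apply: eq_card => C; rewrite [in RHS]inE;
      apply/imsetP/andP => [[v vr ->]|[/componentsP[v ->] bv]].
    by move: vr; rewrite inE => /andP[_ bv]; split=> //; apply/componentsP; exists v.
  exists (fingraph.root e v); last by rewrite component_root.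
  by rewrite inE component_root bv root_root ?eqxx //; exact: connectC.
move=> u v; rewrite !inE => /andP[/eqP ru _] /andP[/eqP rv _] uv.
rewrite -ru -rv; apply: root_component; rewrite -uv; exact: component_refl.
Qed.

(** D.1 is the side of the component of v that contains v, and D.2 is a vertex of
    the other side. *)
Definition side_data v (D : {set 'I_n} * 'I_n) : Prop :=
  [/\ v \in D.1, D.1 \subset component v, D.2 \in component v :\: D.1 &
    forall u w, u \in component v -> e u w -> (u \in D.1) != (w \in D.1)].

Lemma side_data_exists v :
  bipartite e (component v) -> ~~ isolated v -> exists D, side_data v D.
Proof.
move=> /(bipartite_side e_sym)[B HB] /forallPn[w]; rewrite negbK => vw.
have stay := component_step e_sym (x := v).
have vv := component_refl e v; have wv := stay _ _ vv vw; have vwB := HB _ _ vv vw.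
exists ([set u in component v | (u \in B) == (v \in B)], w); split => /=.
- by rewrite in_set vv eqxx.
- by apply/subsetP => u; rewrite in_set => /andP[].
- by rewrite in_setD in_set wv /= andbT eq_sym.
- move=> x y xv xy; rewrite !in_set /= -!mem_component xv (stay _ _ xv xy) /=; have :=
    HB _ _ xv xy.
  by case: (x \in B); case: (y \in B); case: (v \in B).
Qed.

Lemma selectsP (T : eqType) (js : seq T) (al be : T -> 'I_n) ts : uniq js ->
  selects [seq (al j, be j) | j <- js] ts ->
  exists2 tau : T -> 'I_n, ts = [seq tau j | j <- js] &
    forall j, j \in js -> (tau j == al j) || (tau j == be j).
Proof.
elim: js ts => [|j js IH] [|t ts] //=; first by exists al.
case/andP=> jn ujs /andP[tj /(IH _ ujs)[tau -> tauP]].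
exists (fun i => if i == j then t else tau i) => [|i].
  rewrite eqxx; congr cons; apply/eq_in_map => i ij.
  by case: eqP => // ij'; rewrite -ij' ij in jn.
by rewrite inE; case: eqP => [-> _|_ /= /tauP].
Qed.

Variables (K : fieldType).
Local Notation J := (integral_closure (ideal_pow (edge_ideal e K) k)).

(** For the exponent a of [deep_exponent], the colon ideal of J by x^a is the sum of
    the ideals (A)(B), over the bipartite components with sides A and B, and of
    the variables of the nonbipartite components.  This gives what
    [side_class_nonzero] asks for: the terms of the remainder vanish because
    adding to a both sides of an edge, or a vertex of a nonbipartite component,
    gives an element of J; a selection of one vertex on a single side of each
    component does not, as an exact cover avoiding it shows. *)
Theorem depth_closure_le : lee (depth_quot J) (Fin (num_bipartite_components e)).
Proof.
have /choice[D DP] : forall v, exists D, v \in reps -> ~~ isolated v -> side_data v D.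
  move=> v; case: (boolP ((v \in reps) && ~~ isolated v)) => [/andP[vr vi]|nv].
    have bv : bipartite e (component v) by move: vr; rewrite inE => /andP[].
    by have [D HD] := side_data_exists bv vi; exists D.
  by exists (set0, v) => vr vi; rewrite vr vi in nv.
pose A v := (D v).1; pose be v := (D v).2.
pose js := enum [set v in reps | ~~ isolated v]; pose ws := enum [set v in reps | isolated v].
have jsP v : v \in js -> [/\ v \in reps, ~~ isolated v & side_data v (D v)].
  by rewrite mem_enum in_set => /andP[vr vi]; split=> //; exact: DP.
have wsP v : v \in ws -> v \in reps /\ isolated v.
  by rewrite mem_enum in_set => /andP[].
have repsP v : v \in reps -> fingraph.root e v = v /\ bipartite e (component v).
  by rewrite in_set => /andP[/eqP].
have A_root v u : v \in js -> u \in A v -> fingraph.root e u = v.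
  move=> /jsP[/repsP[rv _] _ [_ /subsetP sub _ _]] /sub /root_component ->; exact: rv.
have be_root v : v \in js -> fingraph.root e (be v) = v.
  move=> /jsP[/repsP[rv _] _ [_ _ + _]]; rewrite in_setD => /andP[_ /root_component ->];
      exact: rv.
have sizes : size js + size ws = num_bipartite_components e.
  rewrite -!cardE -card_reps -(cardsID [set v | isolated v] reps) addnC; congr (_ + _).
    by apply: eq_card => v; rewrite !in_set.
  by apply: eq_card => v; rewrite !in_set andbC.
have no_ws v w : v \in js -> w \in ws -> fingraph.root e w = v -> False.
  by move=> /jsP[_ vi _] /wsP[/repsP[-> _] wi] wv; rewrite -wv wi in vi.
rewrite -sizes; apply: depth_le.
have root_eq u v : e u v -> fingraph.root e u = fingraph.root e v.
  by move=> uv; apply: root_component; rewrite mem_component connectC // connect1.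
have isolated_root v u : isolated v -> u \in component v -> u = v.
  move=> /forallP iv; rewrite mem_component => /connectP[[|x p] /= + ->] //.
  by rewrite (negPf (iv x)).
have js_root v u : bipartite e (component v) -> e v u -> fingraph.root e v \in js.
  move=> bv vu; rewrite mem_enum in_set; apply/andP; split.
    by rewrite in_set component_root bv root_root ?eqxx //; exact: connectC.
  apply/negP => ir; have vr : v \in component (fingraph.root e v).
    by rewrite component_root component_refl.
  have E := isolated_root _ _ ir vr; move: ir; rewrite -E => /forallP/(_ u).
  by rewrite vu.
have tau_root tau : (forall j, j \in js -> (tau j == j) || (tau j == be j)) ->
    forall j, j \in js -> fingraph.root e (tau j) = j.
  move=> tauP j jj; case/orP: (tauP j jj) => /eqP ->; last exact: be_root.
  by have [/repsP[]] := jsP j jj.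
apply: (@side_class_nonzero K n J (fun m => heavy e k m) (@closure_heavy _ _ e_sym K k) _ ws
    _ js A id be deep_exponent).
- by move=> m m'; apply: heavy_le => v; rewrite mnmDE leq_addr.
- by move=> v /jsP[_ _ []].
- by move=> v /jsP[_ _ [_ _ + _]]; rewrite in_setD => /andP[].
- move=> v v' vj v'j vv'; apply/andP; split; apply/negP => H; move: vv'.
    have [/repsP[rv _] _ _] := jsP v vj.
    by rewrite -(A_root _ _ v'j H) rv eqxx.
  by rewrite -(A_root _ _ v'j H) be_root // eqxx.
- move=> v w vj ww; apply/negP => wA; exact: (no_ws v w vj ww (A_root _ _ vj wA)).
- exact: enum_uniq.
- exact: enum_uniq.
- by move=> v v' u vj v'j uA uA'; rewrite -(A_root _ _ vj uA) (A_root _ _ v'j uA').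
- move=> v; case: (boolP (bipartite e (component v))) => bv; last first.
    apply: Or44; rewrite GRing.mulrC -mpolyXD; apply: heavy_mem => //; apply: deep_heavy.
      apply: contrapT => none; case/negP: bv; apply/existsP; exists set0.
      apply/forall_inP => u _; apply/forall_inP => w _; apply/implyP => uw.
      by case: none; exists u, w.
    move=> P _ ex; rewrite total_mnm1.
    exact: leq_add (total_odd_vec ex bv) (exact_nonbipartite e_sym ex bv).
  pose r := fingraph.root e v.
  have rr : r \in reps by rewrite in_set component_root bv root_root ?eqxx //; exact: connectC.
  have vr : v \in component r by rewrite component_root component_refl.
  case: (boolP (isolated r)) => ir.
    by apply: Or42; rewrite (isolated_root _ _ ir vr) mem_enum in_set rr.
  have rj : r \in js by rewrite mem_enum in_set rr.
  case: (boolP (v \in A r)) => vA; first by apply: Or41; exists r.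
  apply: Or43; exists r => // u uA; rewrite GRing.mulrC -!mpolyXD; apply: heavy_mem => //.
  apply: deep_heavy.
    by case/forallPn: (ir) => w; rewrite negbK => rw; exists r, w.
  move=> P _ ex; rewrite total_mnmD !total_mnm1.
  have [_ _ [_ /subsetP sub _ alt]] := jsP r rj.
  by rewrite [cmult P v + _]addnC (exact_bipartite e_sym ex alt (sub u uA) vr uA vA) leq_addl.
- move=> ts /(selectsP (enum_uniq _))[tau -> tauP].
  have tr := tau_root tau tauP.
  (* On a bipartite component the cover is the side that the selection avoids;
     on the other components, it consists of all the left copies. *)
  pose L v := if bipartite e (component v)
    then (v \in A (fingraph.root e v)) != (tau (fingraph.root e v) \in A (fingraph.root e v))
        else true.
  pose P := ([set v | L v], [set v | bipartite e (component v) && L v]).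
  have ex : exact_dcover e P.
    move=> u w uw; rewrite !in_set /L -(component_edge e_sym uw) -(root_eq u w uw).
    case: ifP => //= bu; have rj := js_root u w bu uw.
    have [_ _ [_ _ _ alt]] := jsP _ rj.
    have := alt u w; rewrite component_root component_refl => /(_ isT uw).
    rewrite -/(A _); case: (u \in _); case: (w \in _); by case: (tau _ \in _).
  have cP : dcover e P.
    by apply/bicoverP => u w uw; rewrite (ex u w uw) orNb.
  have zero j : j \in js -> cmult P (tau j) = 0.
    move=> jj; rewrite /cmult !in_set /L tr // eqxx.
    by have [/repsP[_ bj] _ _] := jsP j jj; rewrite -(component_root (tau j)) tr // bj.
  split.
    apply: (deep_light cP ex).
      rewrite /odd_vec; case: pickP => [t nt|_]; last by rewrite total0.
      by rewrite total_point /cmult !in_set (negPf nt) /L (negPf nt).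
    rewrite total_mnm_sum big_map big1_seq // => j /andP[_ jj]; exact: zero.
  move=> w ww; have [/repsP[_ bw] iw] := wsP w ww.
  rewrite mnmDE deep_isolated // mnm_sumE big_map big1_seq // => j /andP[_ jj].
  rewrite mnm1E; case: eqP => // E; case: (no_ws j w jj ww); by rewrite -E tr.
Qed.
End DeepMonomial.

Theorem theorem3p2 (K : fieldType) (n : nat) (e : rel 'I_n)
    (e_sym : symmetric e) (e_irr : irreflexive e) :
  (forall k : nat, (1 <= k)%N ->
     lee (Fin (num_bipartite_components e))
         (sdepth_quot (integral_closure (ideal_pow (edge_ideal e K) k))))
  /\
  (exists k0 : nat, forall k : nat, (k0 <= k)%N ->
     lee (depth_quot (integral_closure (ideal_pow (edge_ideal e K) k)))
         (sdepth_quot (integral_closure (ideal_pow (edge_ideal e K) k)))).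
Proof.
split=> [k _|]; first exact: sdepth_closure_ge.
exists (edges e).+1 => k k_big.
exact: lee_trans (depth_closure_le e_sym k_big K) (sdepth_closure_ge e_sym e_irr k K).
Qed.
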